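(* For every real $p>1$ and every positive integer $n$ there exists a constant $C_{p,n}$, depending only on $p$ and $n$, such that for all natural numbers $N_1,\dots,N_n$ the group $A:=\bigoplus_{m=1}^n \mathbb Z_{m+1}^{N_m}$ satisfies $$\|M^A f\|_{L^p(A)}\le C_{p,n}\,\|f\|_{L^p(A)}\qquad\text{for all } f:A\to\mathbb C.$$ In particular $C_{p,n}$ has no direct dependence on $A$ (that is, on $N_1,\dots,N_n$).
   Context: Write an element of $A=\bigoplus_{m=1}^n\mathbb Z_{m+1}^{N_m}$ as $y=\bigoplus_{m=1}^n (y_m^1,\dots,y_m^{N_m})$ with $y_m^j\in\mathbb Z_{m+1}$, and set $|y|:=|\{(m,j):1\le m\le n,\ 1\le j\le N_m,\ y_m^j\ne 0\}|$, the number of nonzero components. For an integer $r$ with $0\le r\le N_1+\dots+N_n$ let $\sigma_r^A:=\frac{1}{|\{x\in A:|x|=r\}|}1_{\{|x|=r\}}$. The spherical maximal operator is $M^A f(x):=\sup_{r>0}|\sigma_r^A*f(x)|$, the supremum being over integers $0<r\le N_1+\dots+N_n$. Natural numbers may be $0$ (a group $\mathbb Z_{m+1}^{0}$ is trivial; a supremum over the empty set is $0$). Convolution is $g*f(x)=\sum_{y\in A}g(y)f(x-y)$, and $L^p$ norms are with respect to counting measure. *)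

(* Defs.v *)
From HB Require Import structures.
From mathcomp Require Import all_boot all_order all_algebra.
From mathcomp Require Import all_classical all_reals.
From mathcomp Require Import exp.
From mathcomp Require Import complex.

Set Implicit Arguments.
Unset Strict Implicit.
Unset Printing Implicit Defensive.

Import Order.TTheory GRing.Theory Num.Theory.
Local Open Scope ring_scope.
Local Open Scope complex_scope.

(* The indices m = 1, ..., n are shifted to 'I_n: the ordinal m stands for     *)
(* m + 1, so its cyclic factor is 'Z_m.+2 (the modulus is always at least 2)  *)
(* and has multiplicity N m. A pair (m, j) is an element of                   *)
(* {m : 'I_n & 'I_(N m)}.                                                     *)
Definition cyclic_sum (n : nat) (N : 'I_n -> nat) : Type :=
  {dffun forall k : {m : 'I_n & 'I_(N m)}, 'Z_((tag k).+2)}.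

(* MathComp gives a Z-module structure to {ffun I -> V} only when V does not  *)
(* depend on the index, so the pointwise one is declared here.                *)
Section CyclicSum.
Variables (n : nat) (N : 'I_n -> nat).

HB.instance Definition _ := Finite.copy (cyclic_sum N)
  {dffun forall k : {m : 'I_n & 'I_(N m)}, 'Z_((tag k).+2)}.

Definition csum_zero : cyclic_sum N :=
  [ffun k : {m : 'I_n & 'I_(N m)} => 0 : 'Z_((tag k).+2)].
Definition csum_opp (x : cyclic_sum N) : cyclic_sum N :=
  [ffun k : {m : 'I_n & 'I_(N m)} => - x k : 'Z_((tag k).+2)].
Definition csum_add (x y : cyclic_sum N) : cyclic_sum N :=
  [ffun k : {m : 'I_n & 'I_(N m)} => x k + y k : 'Z_((tag k).+2)].

Fact csum_addA : associative csum_add.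
Proof. by move=> x y z; apply/ffunP => k; rewrite !ffunE addrA. Qed.
Fact csum_addC : commutative csum_add.
Proof. by move=> x y; apply/ffunP => k; rewrite !ffunE addrC. Qed.
Fact csum_add0 : left_id csum_zero csum_add.
Proof. by move=> x; apply/ffunP => k; rewrite !ffunE add0r. Qed.
Fact csum_addN : left_inverse csum_zero csum_opp csum_add.
Proof. by move=> x; apply/ffunP => k; rewrite !ffunE addNr. Qed.

HB.instance Definition _ := GRing.isZmodule.Build (cyclic_sum N)
  csum_addA csum_addC csum_add0 csum_addN.

Definition csum_weight (y : cyclic_sum N) : nat :=
  #|[set k : {m : 'I_n & 'I_(N m)} | y k != 0]|.

Definition csum_rank : nat := (\sum_(m < n) N m)%N.

End CyclicSum.

Definition convolution (R : realType) (A : finZmodType) (g f : A -> R[i])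
    (x : A) : R[i] :=
  \sum_(y : A) g y * f (x - y).

Definition sphere (n : nat) (N : 'I_n -> nat) (r : nat) : {set cyclic_sum N} :=
  [set x | csum_weight x == r].

Definition sphere_measure (R : realType) (n : nat) (N : 'I_n -> nat) (r : nat)
    (x : cyclic_sum N) : R[i] :=
  #|sphere N r|%:R^-1 * (x \in sphere N r)%:R.

(* A maximum of nonnegative reals, so the base value 0 only matters when the  *)
(* set of radii is empty.                                                     *)
Definition spherical_maximal (R : realType) (n : nat) (N : 'I_n -> nat)
    (f : cyclic_sum N -> R[i]) (x : cyclic_sum N) : R :=
  \big[Num.max/0]_(1 <= r < (csum_rank N).+1)
    Normc.normc (convolution (@sphere_measure R n N r) f x).

Definition lp_norm (R : realType) (T : finType) (p : R) (f : T -> R[i]) : R :=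
  (\sum_(x : T) Normc.normc (f x) `^ p) `^ p^-1.

(* Main.v *)
(* The sphere of radius r in A is a disjoint union of products of spheres in  *)
(* the factors Z_{m+1}^{N_m}, so the maximal operator of A is dominated by    *)
(* the composition of those of the factors, and one modulus q is enough. For  *)
(* f >= 0 write T_r f for the sphere averages on Z_q^M and suppose q >= 3.    *)
(*                                                                            *)
(* T_r is the average over r-subsets of products of commuting one-coordinate  *)
(* steps, whose eigenvalues are 1 and -1/(q-1). Since these are bounded away  *)
(* from -1, the m-th differences of the eigenvalues of T_r in r are dominated *)
(* by those of a completely monotone sequence, which bounds the square        *)
(* function (sum_r r^(2m-1) |D^m T_r f|^2)^(1/2) in L^2 for every m. On the   *)
(* other hand, averages over random coordinate subgroups are reversed         *)
(* martingales as the subgroups grow, and binomial mixtures of the T_r; so    *)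
(* Doob's inequality bounds the Cesaro means of T_r f in every L^p, p > 1.    *)
(* Comparing T_n with its means over windows of length n / L costs a factor L *)
(* on the Cesaro side and gains L^(-m+1/2) on the side of the square          *)
(* function. Optimising L pointwise, for functions bounded by 1, and summing  *)
(* over dyadic level sets of f gives the maximal inequality for all p > 1.    *)
(*                                                                            *)
(* For q = 2 the eigenvalue -1 occurs. Split the coordinates into triples: in *)
(* each of them the vectors of even weight form a group of order 4 all of     *)
(* whose nonzero elements have weight 2. The case q = 4 applied to these      *)
(* groups, averaged over all permutations of the coordinates, gives the even  *)
(* radii up to N/2; one spare coordinate and the reflection by the all-ones   *)
(* vector give the others.                                                    *)

From HB Require Import structures.
Require Import Defs.
From mathcomp Require Import all_boot all_order all_algebra.
From mathcomp Require Import all_fingroup.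
From mathcomp Require Import all_classical all_reals.
From mathcomp Require Import exp.
From mathcomp Require Import complex.
From mathcomp Require Import ring lra zify.

Set Implicit Arguments.
Unset Strict Implicit.
Unset Printing Implicit Defensive.

Import Order.TTheory GRing.Theory Num.Theory.
Local Open Scope ring_scope.

(** * Inequalities for real powers *)

(** Functions are elements of the convolution algebra [galg], and the unnormalised spheres of all
    radii are the coefficients of one polynomial, the product over the coordinates k of 1 + [gaxis]
    k X ([coef_sphere]). [maximal_bound] is a maximal inequality for all coefficients of a
    polynomial at once. It passes to products ([maximal_boundM]), so the coordinates of one modulus
    can be treated by themselves ([fibre_maximal_bound]), with a constant that does not see the
    multiplicities.

    For q >= 3 the estimate is proved for any family of subgroups of order q in any finite abelian
    group ([subgroup_spheres_maximal]), because only the idempotents of the subgroups enter. They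
    commute, which gives the joint spectral decomposition behind the L^2 bound [sum_gdiff_le]; their
    products are the averages in Doob's inequality [doob_psum], which [sphere_cesaro] transfers to
    Cesaro means of spheres. [window_bound] plays the two bounds against each other at a scale L and
    [window_optimize] chooses L at each point. The outcome is an inequality between two exponents p0
    < p1 for functions with values in [0, 1] ([restricted_maximal]), from which dyadic levels
    recover every p > 1.

    This generality also settles q = 2: the even-weight subgroups of coordinate triples form such a
    family with q = 4, and summing their spheres over all coordinate permutations returns spheres of
    even radius in the cube ([cube_maximal_bound]). *)

Section PowerInequalities.
Variable R : realType.
Implicit Types a b p : R.

(** This is the tangent-line bound a^p >= b^p + p b^(p - 1) (a - b) for the convex function t^p; it
    drives both [powR_jensen] and Doob's inequality. *)
Lemma powR_young p a b : 1 < p -> 0 <= a -> 0 <= b ->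
  p * (b `^ (p - 1) * a) <= a `^ p + (p - 1) * b `^ p.
Proof.
move=> p1 a0 b0.
have p0 : 0 < p by lra.
have p10 : 0 < p - 1 by lra.
have q0 : 0 < p / (p - 1) by rewrite divr_gt0.
have pq : p^-1 + (p / (p - 1))^-1 = 1 by field; rewrite !gt_eqF.
have := conjugate_powR a0 (powR_ge0 b (p - 1)) p0 q0 pq.
rewrite -powRrM mulrCA divff ?gt_eqF// mulr1 mulrC => h.
have -> : a `^ p + (p - 1) * b `^ p =
    p * (a `^ p / p + b `^ p / (p / (p - 1))).
  by field; rewrite !gt_eqF.
by rewrite ler_pM2l.
Qed.

Lemma powR_le p a b : 0 <= p -> 0 <= a -> a <= b -> a `^ p <= b `^ p.
Proof.
by move=> p0 a0 ab; apply: ge0_ler_powR; rewrite ?nnegrE// (le_trans a0 ab).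
Qed.

Lemma powR_jensen (I : finType) p (w a : I -> R) : 1 < p ->
  (forall i, 0 <= w i) -> \sum_i w i = 1 -> (forall i, 0 <= a i) ->
  (\sum_i w i * a i) `^ p <= \sum_i w i * a i `^ p.
Proof.
move=> p1 w0 w1 a0; set b := \sum_i _.
have b0 : 0 <= b by apply: sumr_ge0 => i _; rewrite mulr_ge0.
have p0 : 0 < p by lra.
have : \sum_i w i * (p * (b `^ (p - 1) * a i)) <=
       \sum_i w i * (a i `^ p + (p - 1) * b `^ p).
  by apply: ler_sum => i _; rewrite ler_wpM2l// powR_young.
rewrite [leRHS](_ : _ = \sum_i w i * a i `^ p + (p - 1) * b `^ p); last first.
  by under eq_bigr do rewrite mulrDr; rewrite big_split -mulr_suml w1 mul1r.
rewrite [leLHS](_ : _ = p * b `^ p); first by move=> ?; lra.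
rewrite -(mulr_powRB1 b0 p0) {3}/b mulr_suml mulr_sumr.
by apply: eq_bigr => i _; ring.
Qed.

Lemma powRD_le p a b : 0 <= p -> 0 <= a -> 0 <= b ->
  (a + b) `^ p <= 2 `^ p * (a `^ p + b `^ p).
Proof.
move=> p0 a0 b0.
have [ab|ba] := leP a b.
  apply: (le_trans (powR_le p0 _ (_ : a + b <= 2 * b))); [lra|lra|].
  by rewrite powRM// ler_wpM2l ?powR_ge0// lerDr powR_ge0.
apply: (le_trans (powR_le p0 _ (_ : a + b <= 2 * a))); [lra|lra|].
by rewrite powRM// ler_wpM2l ?powR_ge0// lerDl powR_ge0.
Qed.

Lemma sum_ord_const (n : nat) (a : R) : \sum_(i < n) a = n%:R * a.
Proof. by rewrite sumr_const card_ord mulr_natl. Qed.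

Lemma sqr_sum_le (n : nat) (v : nat -> R) :
  (\sum_(i < n) v i) ^+ 2 <= n%:R * \sum_(i < n) v i ^+ 2.
Proof.
elim: n => [|n IHn]; first by rewrite !big_ord0 mulr0 expr0n.
rewrite !big_ord_recr/= -natr1; set s := \sum_(i < n) _ in IHn *.
set q := \sum_(i < n) _ in IHn *; set x := v n.
suff : 2 * (s * x) <= q + n%:R * x ^+ 2 by move=> ?; nra.
have [n0|n0] := posnP n.
  by rewrite /s /q n0 !big_ord0; lra.
have n0R : 0 < n%:R :> R by rewrite ltr0n.
rewrite -(ler_pM2l n0R); have := sqr_ge0 (s - n%:R * x); nra.
Qed.

End PowerInequalities.

(** * Completely monotone sequences and Cesaro means *)

Lemma expn_bin_le (r m : nat) : (r.+1 ^ m <= m`! * 'C(r + m, m))%N.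
Proof.
elim: m => [|m IHm]; first by rewrite bin0.
have /= h := mul_bin_diag (r + m).+1 m.
rewrite factS addnS mulnAC -h mulnAC -mulnA expnS.
by rewrite leq_mul// ltnS leq_addr.
Qed.

Lemma sum_bin_hockey (r m : nat) :
  (\sum_(j < r.+1) 'C(j + m, m) = 'C(r + m.+1, m.+1))%N.
Proof.
elim: r => [|r IHr]; first by rewrite big_ord1 !add0n !binn.
by rewrite big_ord_recr/= IHr [in RHS]addSn binS addSnnS addnC.
Qed.

Section MonotoneDifferences.
Variables (R : realType) (M : nat) (k : R) (y : nat -> nat -> R).
Hypothesis k0 : 0 < k.
Hypothesis y0 : forall r m, (r + m <= M)%N -> 0 <= y r m.
Hypothesis yS : forall r m, (r + m < M)%N -> y r m.+1 = k * (y r m - y r.+1 m).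
Hypothesis y00 : y 0 0 <= 1.

(* Abel summation: the differences of C(r + m + 1, m + 1) in r are C(r + m, m). *)
Lemma sum_bin_diff_le m n : (n + m <= M)%N ->
  \sum_(r < n) 'C(r + m, m)%:R * y r m.+1 <= k ^+ m.+1.
Proof.
elim: m n => [|m IHm] n nM.
  rewrite expr1 [leLHS](_ : _ = k * (y 0 0 - y n 0)); last first.
    elim: n nM => [_|n IHn nM]; first by rewrite big_ord0 subrr mulr0.
    by rewrite big_ord_recr/= IHn ?yS; [rewrite bin0; ring|lia|lia].
  have : 0 <= y n 0 by apply: y0; lia.
  by move: y00 => ? ?; rewrite -[leRHS]mulr1 ler_pM2l//; lra.
have nM' : (n + m <= M)%N by lia.
rewrite [leLHS](_ : _ = k * (\sum_(r < n) 'C(r + m, m)%:R * y r m.+1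
    - 'C(n + m, m.+1)%:R * y n m.+1)); last first.
  elim: n nM {nM'} => [_|n IHn nM].
    by rewrite !big_ord0 bin_small// mul0r subrr mulr0.
  rewrite !big_ord_recr/= IHn ?(@yS n m.+1); [|lia|lia].
  by rewrite addSn !addnS binS natrD; ring.
have : 0 <= y n m.+1 by apply: y0; lia.
move=> h; rewrite exprS ler_pM2l//.
by apply: (le_trans _ (IHm n nM')); rewrite gerBl mulr_ge0.
Qed.

(** [y r m.+1] decreases in r because the next differences are nonnegative, so the sum in
    [sum_bin_diff_le] is at least its last y times the total of its weights. *)
Lemma bin_diff_le r m : (r + m.+1 <= M)%N ->
  'C(r + m.+1, m.+1)%:R * y r m.+1 <= k ^+ m.+1.
Proof.
move=> rM.
have ydec i : (i <= r)%N -> y r m.+1 <= y (r - i) m.+1.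
  elim: i => [|i IHi] ir; first by rewrite subn0.
  apply: (le_trans (IHi (ltnW ir))).
  have -> : (r - i = (r - i.+1).+1)%N by lia.
  have : 0 <= y (r - i.+1) m.+2 by apply: y0; lia.
  by rewrite yS; [rewrite pmulr_rge0// subr_ge0|lia].
apply: (le_trans _ (sum_bin_diff_le (n := r.+1) (m := m) _)); last by lia.
rewrite -sum_bin_hockey natr_sum mulr_suml; apply: ler_sum => j _.
rewrite ler_wpM2l//; have := ydec (r - j)%N (leq_subr _ _).
by rewrite subKn// -ltnS.
Qed.

(** Of the 2m + 1 powers of r + 1, m + 1 are spent with one factor y on the pointwise bound
    [bin_diff_le], the other m with the other factor on [sum_bin_diff_le]. *)
Lemma sum_sqr_diff_le m :
  \sum_(r < M - m) r.+1%:R ^+ (m + m.+1) * y r m.+1 ^+ 2 <=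
  (m`! * m.+1`!)%:R * (k ^+ m.+1 * k ^+ m.+1).
Proof.
have [Mm|mM] := leqP M m.
  by rewrite (eqP Mm) big_ord0 mulr_ge0// mulr_ge0// exprn_ge0// ltW.
apply: (@le_trans _ _ (\sum_(r < M - m) (m`! * m.+1`!)%:R *
    ('C(r + m, m)%:R * y r m.+1 * k ^+ m.+1))); last first.
  rewrite -mulr_sumr -mulr_suml ler_wpM2l// ler_wpM2r//.
    by rewrite exprn_ge0// ltW.
  by apply: sum_bin_diff_le; lia.
apply: ler_sum => r _.
have rM : (r + m.+1 <= M)%N by have := ltn_ord r; lia.
have yr : 0 <= y r m.+1 by apply: y0.
apply: (@le_trans _ _ ((m`! * m.+1`!)%:R * ('C(r + m, m)%:R * y r m.+1 *
   ('C(r + m.+1, m.+1)%:R * y r m.+1)))); last first.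
  by rewrite ler_wpM2l// ler_wpM2l ?mulr_ge0// bin_diff_le.
rewrite [leRHS](_ : _ = (m`! * 'C(r + m, m))%:R * (m.+1`! *
  'C(r + m.+1, m.+1))%:R * y r m.+1 ^+ 2); last by rewrite !natrM; ring.
rewrite exprD ler_wpM2r ?sqr_ge0// ler_pM ?exprn_ge0//.
  by rewrite -natrX ler_nat expn_bin_le.
by rewrite -natrX ler_nat expn_bin_le.
Qed.

End MonotoneDifferences.

Section Cesaro.
Variables (R : realType) (b : R).
Hypotheses (b0 : 0 <= b) (b13 : 3 * b <= 1).

(* The probability of j successes in k independent trials of success rate 1 - b. *)
Fixpoint binw (k j : nat) : R :=
  match k, j with
  | 0, 0 => 1
  | 0, _.+1 => 0
  | k'.+1, 0 => b * binw k' 0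
  | k'.+1, j'.+1 => b * binw k' j + (1 - b) * binw k' j'
  end.

Lemma binw_ge0 k j : 0 <= binw k j.
Proof.
move: (b0) (b13) => hb0 hb1.
elim: k j => [|k IHk] [|j]//=; first by rewrite mulr_ge0.
by rewrite addr_ge0// mulr_ge0//; lra.
Qed.

Lemma binw_small k j : (k < j)%N -> binw k j = 0.
Proof.
elim: k j => [|k IHk] [|j]//= kj; rewrite !IHk ?mulr0 ?addr0//.
by lia.
Qed.

Lemma sum_binw k n : (k < n)%N -> \sum_(j < n) binw k j = 1.
Proof.
elim: k n => [|k IHk] [|n]// kn; rewrite big_ord_recl/=.
  by rewrite big1// addr0.
rewrite big_split/= -!mulr_sumr IHk//.
have := IHk n.+1; rewrite big_ord_recl/= => h.
have {h} := h (ltnW kn); set s := \sum_(i < n) _.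
by rewrite /bump/= => h; rewrite addrA -mulrDr h; ring.
Qed.

(** The expected number of times k <= K at which exactly j successes have occurred. *)
Definition sum_binw_fst K j := \sum_(k < K.+1) binw k j.

Lemma sum_binw_fstS K j : sum_binw_fst K j.+1 <= sum_binw_fst K j.
Proof.
move: (b0) (b13) => hb0 hb1.
suff : (1 - b) * sum_binw_fst K j.+1 <= (1 - b) * sum_binw_fst K j.
  by rewrite ler_pM2l//; lra.
have le K' i : \sum_(k < K') binw k i <= sum_binw_fst K' i.
  by rewrite /sum_binw_fst big_ord_recr/= lerDl binw_ge0.
(* Summing the recursion of [binw] over k bounds the sum at j + 1 by b times itself plus 1 - b times
   the sum at j. *)
rewrite mulrBl mul1r lerBlDl {1}/sum_binw_fst big_ord_recl/= add0r.
rewrite big_split/= -!mulr_sumr lerD// ler_wpM2l//; first exact: le.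
  by lra.
exact: le.
Qed.

Lemma sum_binw_fst_le K j : sum_binw_fst K j <= 3 / 2.
Proof.
move: (b0) (b13) => hb0 hb1.
elim: j => [|j IHj]; last exact: le_trans (sum_binw_fstS K j) IHj.
suff : (1 - b) * sum_binw_fst K 0 <= 1.
  by have : 0 <= sum_binw_fst K 0; [apply: sumr_ge0 => *; exact: binw_ge0|nra].
rewrite /sum_binw_fst; elim: K => [|K IHK].
  by rewrite big_ord1/= mulr1; lra.
rewrite big_ord_recl/= -mulr_sumr.
set s := \sum_(k < K.+1) _ in IHK *.
have : 0 <= s by apply: sumr_ge0 => *; exact: binw_ge0.
nra.
Qed.

(* The 3n + 1 sums decrease in j, are at most 3/2 and have total 3n + 1, which *)
(* keeps the one at j = n away from 0.                                         *)
Lemma sum_binw_fst_ge n : (0 < n)%N -> 1 / 2 <= sum_binw_fst (3 * n) n.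
Proof.
move=> n0; set K := (3 * n)%N.
have tot : \sum_(j < K.+1) sum_binw_fst K j = K.+1%:R.
  rewrite exchange_big/= (eq_bigr (fun=> 1)); last first.
    by move=> k _; rewrite sum_binw.
  by rewrite sumr_const card_ord.
have dec i j : (i <= j)%N -> sum_binw_fst K j <= sum_binw_fst K i.
  elim: j => [|j IHj]; first by rewrite leqn0 => /eqP->.
  rewrite leq_eqVlt ltnS => /orP[/eqP->//|/IHj].
  exact: le_trans (sum_binw_fstS _ _).
have : \sum_(j < K.+1) sum_binw_fst K j <=
   n.+1%:R * (3 / 2) + (2 * n)%:R * sum_binw_fst K n.
  have -> : K.+1 = (n.+1 + 2 * n)%N by rewrite /K; lia.
  rewrite big_split_ord/=; apply: lerD.
    rewrite -sum_ord_const.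
    by apply: ler_sum => i _; exact: sum_binw_fst_le.
  rewrite -sum_ord_const.
  by apply: ler_sum => i _; apply: dec; lia.
rewrite tot /K -[n.+1%:R]natr1 -[(3 * n).+1%:R]natr1 !natrM => h.
have n1 : 1 <= n%:R :> R by rewrite ler1n.
move: h; set w := sum_binw_fst _ _; set z : R := n%:R in n1 * => h.
rewrite leNgt; apply/negP => w12.
have : 0 < z * (1 - 2 * w) by rewrite mulr_gt0; lra.
nra.
Qed.

(** For 0 < n and 3n <= M, the sum of [y 0 k] over k <= 3n is at most (3n + 1) u, and as a binomial
    mixture it puts weight at least 1/2 on each [y j 0] with j <= n. For 3n > M the mean over all j
    <= M is comparable up to a factor 3. *)
Lemma cesaro_bound (M : nat) (y : nat -> nat -> R) (u v : R) :
    (forall i j, (i + j <= M)%N -> 0 <= y i j) ->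
    (forall i j, (i + j < M)%N ->
       y i j.+1 = b * y i j + (1 - b) * y i.+1 j) ->
    (forall k, (k <= M)%N -> y 0 k <= u) ->
    \sum_(j < M.+1) y j 0 <= M.+1%:R * v ->
  forall n, (n <= M)%N -> \sum_(j < n.+1) y j 0 <= n.+1%:R * (6 * (u + v)).
Proof.
move=> y0 yS yu yv n nM.
have u0 : 0 <= u by apply: (le_trans (y0 0 0 _) (yu 0 _)).
have v0 : 0 <= v.
  rewrite -(pmulr_rge0 _ (ltr0Sn R M)); apply: le_trans yv.
  by apply: sumr_ge0 => i _; apply: y0; have := ltn_ord i; lia.
have [n3M|Mn3] := leqP (3 * n) M; last first.
  apply: (@le_trans _ _ (M.+1%:R * v)).
    apply: le_trans yv; have -> : M.+1 = (n.+1 + (M - n))%N by lia.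
    rewrite big_split_ord/= lerDl; apply: sumr_ge0 => i _; apply: y0.
    by have := ltn_ord i; lia.
  have h : M.+1%:R <= 3 * n.+1%:R :> R by rewrite -natrM ler_nat; lia.
  apply: (le_trans (ler_wpM2r v0 h)).
  by rewrite -mulrA mulrCA ler_wpM2l//; lra.
have ymix k i : (i + k <= M)%N ->
    y i k = \sum_(j < k.+1) binw k j * y (i + j)%N 0%N.
  elim: k i => [|k IHk] i ikM; first by rewrite big_ord1 /= mul1r addn0.
  rewrite yS; last by lia.
  rewrite !IHk; [|lia|lia].
  rewrite [RHS]big_ord_recl/= [in RHS](eq_bigr (fun j : 'I_k.+1 =>
    b * (binw k j.+1 * y (i + j.+1)%N 0%N) +
    (1 - b) * (binw k j * y (i.+1 + j)%N 0%N))); last first.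
    by move=> j _; rewrite /bump/= add1n addSnnS; ring.
  rewrite big_split/= -!mulr_sumr addrA; congr (_ + _).
  rewrite [in LHS]big_ord_recl [in RHS]big_ord_recr/= (binw_small (ltnSn k)).
  by rewrite mul0r addr0 mulrDr mulrA.
case: n => [|n] in nM n3M *.
  by rewrite big_ord1; have := yu 0%N isT; lra.
set K := (3 * n.+1)%N in n3M *.
have : \sum_(k < K.+1) y 0 k <= K.+1%:R * u.
  rewrite -sum_ord_const.
  by apply: ler_sum => k _; apply: yu; have := ltn_ord k; lia.
have -> : \sum_(k < K.+1) y 0 k = \sum_(j < K.+1) sum_binw_fst K j * y j 0.
  under [RHS]eq_bigr do rewrite mulr_suml.
  rewrite exchange_big/=; apply: eq_bigr => k _.
  rewrite ymix; last by have := ltn_ord k; lia.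
  rewrite (big_ord_widen K.+1 (fun j => binw k j * y (0 + j)%N 0%N))//.
  rewrite big_mkcond/=; apply: eq_bigr => j _; rewrite add0n ltnS.
  by case: leqP => // kj; rewrite binw_small ?mul0r.
move=> h.
have : 1 / 2 * \sum_(j < n.+2) y j 0 <=
    \sum_(j < K.+1) sum_binw_fst K j * y j 0.
  have -> : K.+1 = (n.+2 + (2 * n.+1))%N by rewrite /K; lia.
  rewrite big_split_ord/= -[leLHS]addr0; apply: lerD; last first.
    apply: sumr_ge0 => j _; rewrite mulr_ge0//.
      by apply: sumr_ge0 => *; exact: binw_ge0.
    by apply: y0; have := ltn_ord j; rewrite /K in n3M; lia.
  rewrite mulr_sumr; apply: ler_sum => j _.
  rewrite ler_wpM2r//; first by apply: y0; have := ltn_ord j; lia.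
  apply: (le_trans (sum_binw_fst_ge (n := n.+1) isT)); rewrite -/K.
  have : (j <= n.+1)%N by rewrite -ltnS.
  move: (j : nat) => i; elim: (n.+1) => [|l IHl].
    by rewrite leqn0 => /eqP->.
  rewrite leq_eqVlt => /orP[/eqP->//|/IHl]; exact: le_trans (sum_binw_fstS _ _).
have hK : K.+1%:R <= 3 * n.+2%:R :> R by rewrite -natrM ler_nat /K; lia.
move=> hn; have := ler_wpM2r u0 hK.
have : 0 <= n.+2%:R * v by rewrite mulr_ge0.
lra.
Qed.

End Cesaro.

(** * Smoothing by iterated averages *)

Section Smoothing.
Variable R : realType.
Implicit Types (s : nat -> R) (m n w L : nat).

Definition sdiff s i := s i - s i.+1.
Definition savg w s i := w%:R^-1 * \sum_(h < w) s (i + h)%N.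
Definition ssum w s i := w%:R^-1 * \sum_(h < w) \sum_(l < h) s (i + l)%N.
Definition sres w s i := s i - savg w s i.
Definition sl1 L s := \sum_(i < L) `|s i|.

Lemma sresE w s : (0 < w)%N -> sres w s = ssum w (sdiff s).
Proof.
move=> w0; apply/funext => i.
have wn0 : w%:R != 0 :> R by rewrite pnatr_eq0 -lt0n.
rewrite /sres /ssum (eq_bigr (fun h : 'I_w => s i - s (i + h)%N)); last first.
  move=> h _; elim: (h : nat) => [|l IHl].
    by rewrite big_ord0 addn0 subrr.
  by rewrite big_ord_recr/= IHl /sdiff addnS; ring.
rewrite big_split/= sumr_const card_ord mulrDr sumrN mulrN.
by rewrite -[s i *+ w]mulr_natl mulKf.
Qed.

Lemma sdiff_ssum w s : sdiff (ssum w s) = ssum w (sdiff s).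
Proof.
apply/funext => i; rewrite /sdiff /ssum -mulrBr -sumrB; congr (_ * _).
by apply: eq_bigr => h _; rewrite -sumrB.
Qed.

Lemma iter_sres w m s : (0 < w)%N ->
  iter m (sres w) s = iter m (ssum w) (iter m sdiff s).
Proof.
move=> w0.
have comm l t : sdiff (iter l (ssum w) t) = iter l (ssum w) (sdiff t).
  by elim: l => //= l IHl; rewrite sdiff_ssum IHl.
by elim: m => //= m ->; rewrite sresE// comm.
Qed.

Lemma sl1_widen L L' s : (L <= L')%N -> sl1 L s <= sl1 L' s.
Proof.
move=> LL'; rewrite /sl1 (big_ord_widen L' (fun i => `|s i|))//.
by rewrite [leLHS]big_mkcond/=; apply: ler_sum => i _; case: ifP.
Qed.

Lemma sl1_shift L h w s : (h <= w)%N ->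
  \sum_(i < L) `|s (i + h)%N| <= sl1 (L + w) s.
Proof.
move=> hw; apply: (le_trans _ (sl1_widen s (_ : h + L <= L + w)%N)); last lia.
rewrite /sl1 big_split_ord/= -[leLHS]add0r lerD ?sumr_ge0//.
by apply: ler_sum => i _; rewrite addnC.
Qed.

Lemma ler_norm_savg w s i :
  `|savg w s i| <= w%:R^-1 * \sum_(h < w) `|s (i + h)%N|.
Proof.
by rewrite normrM ger0_norm ?invr_ge0// ler_wpM2l ?invr_ge0// ler_norm_sum.
Qed.

Lemma ler_norm_ssum w s i :
  `|ssum w s i| <= \sum_(h < w) `|s (i + h)%N|.
Proof.
have [->|w0] := posnP w; first by rewrite /ssum !big_ord0 mulr0 normr0.
rewrite normrM ger0_norm ?invr_ge0// ler_pdivrMl ?ltr0n//.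
rewrite -sum_ord_const.
apply: (le_trans (ler_norm_sum _ _ _)).
apply: ler_sum => h _.
apply: (le_trans (ler_norm_sum _ _ _)).
rewrite [leLHS](big_ord_widen w (fun l => `|s (i + l)%N|)); last exact: ltnW.
by rewrite [leLHS]big_mkcond/=; apply: ler_sum => l _; case: ifP.
Qed.

Lemma sl1_sres L w s : (0 < w)%N -> sl1 L (sres w s) <= 2 * sl1 (L + w) s.
Proof.
move=> w0; rewrite mulr_natl mulr2n.
apply: (@le_trans _ _ (\sum_(i < L) (`|s i| + `|savg w s i|))).
  by apply: ler_sum => i _; exact: ler_normB.
rewrite big_split/=; apply: lerD.
  by apply: (sl1_widen s); exact: leq_addr.
apply: (@le_trans _ _
   (w%:R^-1 * \sum_(h < w) \sum_(i < L) `|s (i + h)%N|)).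
  rewrite exchange_big mulr_sumr/=; apply: ler_sum => i _.
  exact: ler_norm_savg.
rewrite ler_pdivrMl ?ltr0n// -sum_ord_const.
by apply: ler_sum => h _; apply: sl1_shift; exact: ltnW.
Qed.

Lemma sl1_ssum L w s : sl1 L (ssum w s) <= w%:R * sl1 (L + w) s.
Proof.
apply: (@le_trans _ _ (\sum_(h < w) \sum_(i < L) `|s (i + h)%N|)).
  rewrite exchange_big/=; apply: ler_sum => i _; exact: ler_norm_ssum.
rewrite -sum_ord_const.
by apply: ler_sum => h _; apply: sl1_shift; exact: ltnW.
Qed.

(* With B = savg w, D = sdiff and G = ssum w one has 1 - B = G D, hence *)
(* 1 = B (1 + (1 - B) + ... + (1 - B)^m) + G^(m + 1) D^(m + 1).         *)
Lemma smoothing m w s : (0 < w)%N ->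
  `|s 0%N| <= w%:R^-1 * 2 ^+ m.+1 * sl1 (m.+1 * w) s +
     w%:R ^+ m * sl1 (m.+1 * w) (iter m.+1 sdiff s).
Proof.
move=> w0.
have dec k : s 0%N = \sum_(i < k) savg w (iter i (sres w) s) 0%N +
    iter k (sres w) s 0%N.
  elim: k => [|k IHk]; first by rewrite big_ord0 add0r.
  by rewrite big_ord_recr/= {1}IHk -addrA {4}/sres subrKC.
rewrite (dec m.+1); apply: (le_trans (ler_normD _ _)); apply: lerD.
  have sl1it k L : sl1 L (iter k (sres w) s) <= 2 ^+ k * sl1 (L + k * w) s.
    elim: k L => [|k IHk] L; first by rewrite expr0 mul1r addn0.
    apply: (le_trans (sl1_sres _ _ w0)); rewrite exprS -mulrA ler_pM2l//.
    by rewrite mulSn addnA.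
  apply: (le_trans (ler_norm_sum _ _ _)).
  apply: (@le_trans _ _ (\sum_(i < m.+1)
      (w%:R^-1 * (2 ^+ i * sl1 (m.+1 * w) s)))).
    apply: ler_sum => i _; apply: (le_trans (ler_norm_savg _ _ _)).
    rewrite ler_wpM2l ?invr_ge0//; apply: (le_trans (sl1it i w)).
    rewrite ler_wpM2l ?exprn_ge0//; apply: sl1_widen.
    by rewrite -mulSn leq_mul2r (ltn_ord i) orbT.
  rewrite -mulr_sumr -mulr_suml -mulrA ler_wpM2l ?invr_ge0// ler_wpM2r//.
    by apply: sumr_ge0.
  elim: m.+1 => [|k IHk]; first by rewrite big_ord0 expr0.
  have : 0 <= 2 ^+ k :> R by rewrite exprn_ge0.
  by rewrite big_ord_recr/= exprS; lra.
rewrite iter_sres//; move: (iter m.+1 sdiff s) => t.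
have sl1it k L : sl1 L (iter k (ssum w) t) <= w%:R ^+ k * sl1 (L + k * w) t.
  elim: k L => [|k IHk] L; first by rewrite expr0 mul1r addn0.
  apply: (le_trans (sl1_ssum _ _ _)); rewrite exprS -mulrA ler_wpM2l//.
  by rewrite mulSn addnA.
(* The outermost [ssum] is evaluated at a single point, where it costs no factor w; hence the
   exponent m and not m + 1. *)
by rewrite mulSn; apply: le_trans (sl1it m w); exact: ler_norm_ssum.
Qed.

Lemma sum_rev_le (f : nat -> R) k a : (k <= a.+1)%N ->
  (forall i, (i <= a)%N -> 0 <= f i) ->
  \sum_(i < k) f (a - i)%N <= \sum_(i < a.+1) f i.
Proof.
move=> ka f0; rewrite [leRHS](reindex_inj rev_ord_inj)/=.
rewrite (big_ord_widen a.+1 (fun i => f (a - i)%N))//.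
rewrite [leLHS]big_mkcond/=; apply: ler_sum => i _; rewrite subSS.
by case: ifP => // _; apply: f0; lia.
Qed.

Section Window.
Variables (M m : nat) (x : nat -> nat -> R) (A : R).
Hypothesis xS : forall r k, (r + k < M)%N -> x r k.+1 = x r k - x r.+1 k.
Hypothesis x0 : forall r, (r <= M)%N -> 0 <= x r 0.
Hypothesis A0 : 0 <= A.
Hypothesis xA : forall n, (n <= M)%N -> \sum_(j < n.+1) x j 0 <= n.+1%:R * A.

Definition window_const : R := 2 ^+ m.+1 * (8 * m.+1)%:R.

(** Apply [smoothing] backwards from n with windows of length about n / L. The window averages cost
    a factor L against the mean bound A; d collects the differences, where Cauchy-Schwarz and r
    being of order n on the window gain a power of L. *)
Lemma window_bound L n : (0 < L)%N -> (n <= M)%N ->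
  exists d : R, [/\ 0 <= d, x n 0 <= window_const * (L%:R * A) + d &
    d ^+ 2 * L%:R ^+ m.+1 <=
    m.+1%:R * \sum_(r < M - m) r.+1%:R ^+ (m + m.+1) * x r m.+1 ^+ 2].
Proof.
move=> L0 nM; set S := \sum_(r < _) _.
have S0 : 0 <= S by apply: sumr_ge0 => r _; rewrite mulr_ge0 ?sqr_ge0// exprn_ge0.
(* The factor 4 (m + 1) ensures, when w > 0, that going back (m + 1) w places and m + 1 more for the
   differences stays at or above n / 2. *)
set w := (n %/ (4 * m.+1 * L))%N.
have D0 : (0 < 4 * m.+1 * L)%N by rewrite !muln_gt0 L0.
have [w0|w0] := posnP w.
  (* Here n is at most of order L, and [x n 0] is bounded as one term of its own mean. *)
  have nL : (n < 4 * m.+1 * L)%N by rewrite ltnNge -divn_gt0// -/w w0.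
  exists 0; rewrite addr0 expr0n/= mul0r; split => //; last exact: mulr_ge0.
  apply: (@le_trans _ _ (n.+1%:R * A)).
    apply: le_trans (xA nM); rewrite big_ord_recr/= lerDr.
    by apply: sumr_ge0 => i _; apply: x0; have := ltn_ord i; lia.
  rewrite mulrA ler_wpM2r// /window_const -mulrA -natrM.
  apply: (@le_trans _ _ (1 * (8 * m.+1 * L)%:R)).
    by rewrite mul1r ler_nat; lia.
  by rewrite ler_wpM2r// exprn_ege1// ler1n.
have wn : (w * (4 * m.+1 * L) <= n)%N by exact: leq_trunc_div.
have nw : (n < (w + 1) * (4 * m.+1 * L))%N by rewrite addn1 ltn_ceil.
pose s i := x (n - i)%N 0.
have sd k i : (i + k <= n)%N ->
    `|iter k sdiff s i| = `|x (n - i - k)%N k|.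
  have : (i + k <= n)%N -> iter k sdiff s i = (-1) ^+ k * x (n - i - k)%N k.
    elim: k i => [|k IHk] i ikn; first by rewrite mul1r subn0.
    have -> : iter k.+1 sdiff s i = iter k sdiff s i - iter k sdiff s i.+1.
      by [].
    rewrite !IHk; [|lia|lia].
    have -> : (n - i.+1 - k = n - i - k.+1)%N by lia.
    rewrite xS; last by lia.
    have -> : (n - i - k.+1).+1 = (n - i - k)%N by lia.
    by rewrite exprS; ring.
  by move=> h /h ->; rewrite normrM normrX normrN1 expr1n mul1r.
have mw : ((m.+1 * w) * 4 <= n)%N by nia.
have := smoothing m s w0.
rewrite {1}/s subn0 ger0_norm ?x0// => h.
exists (w%:R ^+ m * sl1 (m.+1 * w) (iter m.+1 sdiff s)); split.
- by rewrite mulr_ge0 ?exprn_ge0// sumr_ge0.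
- apply: (le_trans h); rewrite lerD2r.
  have : sl1 (m.+1 * w) s <= n.+1%:R * A.
    apply: le_trans (xA nM); rewrite /sl1.
    under eq_bigr => i _ do rewrite ger0_norm ?x0 ?(leq_trans (leq_subr _ _))//.
    apply: (sum_rev_le (f := fun j => x j 0)); first by lia.
    by move=> i il; apply: x0; lia.
  move=> hs; rewrite -mulrA ler_pdivrMl ?ltr0n// /window_const.
  rewrite [leRHS](_ : _ = 2 ^+ m.+1 * ((8 * m.+1 * w * L)%:R * A)); last first.
    by rewrite !natrM; ring.
  rewrite ler_wpM2l ?exprn_ge0//; apply: (le_trans hs); rewrite ler_wpM2r//.
  by rewrite ler_nat; nia.
- rewrite exprMn -exprM.
  have le1 : sl1 (m.+1 * w) (iter m.+1 sdiff s) ^+ 2 *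
      (2 * m.+1 * w * L)%:R ^+ (m + m.+1) <= (m.+1 * w)%:R * S.
    set Q := _%:R ^+ (m + m.+1).
    have := sqr_sum_le (m.+1 * w) (fun i => `|iter m.+1 sdiff s i|).
    rewrite -/(sl1 _ _) => hsq.
    have Q0 : 0 <= Q by rewrite exprn_ge0.
    apply: (le_trans (ler_wpM2r Q0 hsq)); rewrite -mulrA ler_wpM2l//.
    apply: (@le_trans _ _ (\sum_(i < m.+1 * w)
        (n - m.+1 - i).+1%:R ^+ (m + m.+1) * x (n - m.+1 - i)%N m.+1 ^+ 2)).
      rewrite mulr_suml; apply: ler_sum => i _.
      have im := ltn_ord i.
      rewrite sd; last by nia.
      rewrite -normrX ger0_norm ?sqr_ge0//.
      have -> : (n - i - m.+1 = n - m.+1 - i)%N by lia.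
      rewrite mulrC ler_wpM2r ?sqr_ge0// lerXn2r ?nnegrE// ler_nat.
      by nia.
    apply: (@le_trans _ _ (\sum_(i < (n - m.+1).+1)
        i.+1%:R ^+ (m + m.+1) * x i m.+1 ^+ 2)).
      apply: (sum_rev_le (f := fun r => r.+1%:R ^+ (m + m.+1) * x r m.+1 ^+ 2)).
        by nia.
      by move=> i _; rewrite mulr_ge0 ?sqr_ge0// exprn_ge0.
    rewrite /S (big_ord_widen (M - m) (fun r => r.+1%:R ^+ (m + m.+1) *
      x r m.+1 ^+ 2)); last by nia.
    rewrite [leLHS]big_mkcond/=; apply: ler_sum => i _; case: ifP => // _.
    by rewrite mulr_ge0 ?sqr_ge0// exprn_ge0.
  set z := sl1 _ _ in le1 *.
  have wR : 0 < w%:R :> R by rewrite ltr0n.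
  rewrite -(ler_pM2l wR).
  apply: (@le_trans _ _ (z ^+ 2 * (2 * m.+1 * w * L)%:R ^+ (m + m.+1))).
    rewrite [leLHS](_ : _ = z ^+ 2 * (w%:R ^+ (m + m.+1) * L%:R ^+ m.+1)).
      rewrite ler_wpM2l ?sqr_ge0// -!natrX -natrM ler_nat.
      have -> : (2 * m.+1 * w * L = (2 * m.+1) * (w * L))%N by lia.
      rewrite !expnMn.
      (* Of the available L^(2m + 1) only L^(m + 1) is kept. *)
      apply: (@leq_trans (w ^ (m + m.+1) * L ^ (m + m.+1))).
        by rewrite leq_mul2l leq_pexp2l ?orbT//; lia.
      by rewrite leq_pmull// muln_gt0 !expn_gt0.
    rewrite (_ : m + m.+1 = (m * 2).+1)%N; last by lia.
    by rewrite (exprS w%:R (m * 2)); set l := L%:R ^+ _; ring.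
  by apply: (le_trans le1); rewrite natrM mulrAC mulrC.
Qed.

End Window.
End Smoothing.

(** * The convolution algebra of a finite abelian group *)

(** An alias of [{ffun G -> R}], so that the ring product can be convolution instead of the
    pointwise product. *)
Definition galg (R : comNzRingType) (G : finZmodType) : Type := {ffun G -> R}.

Section GroupAlgebra.
Variables (R : comNzRingType) (G : finZmodType).
Implicit Types (f g h k : galg R G) (x y z : G) (a b : R).

HB.instance Definition _ := GRing.Zmodule.copy (galg R G) {ffun G -> R}.

Definition galg_mul f g : galg R G := [ffun x => \sum_y f y * g (x - y)].
Definition galg_pt x : galg R G := [ffun y => (y == x)%:R].
Definition galg_scale a f : galg R G := [ffun x => a * f x].

Fact galg_mulC : commutative galg_mul.
Proof.
move=> f g; apply/ffunP => x; rewrite !ffunE (reindex_inj (subrI x))/=.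
by apply: eq_bigr => y _; rewrite subKr mulrC.
Qed.

Fact galg_mulA : associative galg_mul.
Proof.
move=> f g h; apply/ffunP => x; rewrite !ffunE.
under eq_bigr => y _ do rewrite ffunE mulr_sumr.
under [RHS]eq_bigr => y _ do rewrite ffunE mulr_suml.
rewrite [RHS]exchange_big/=; apply: eq_bigr => y _.
rewrite [RHS](reindex_inj (addrI y))/=; apply: eq_bigr => z _.
by rewrite mulrA opprD addrA [y + z]addrC addrK.
Qed.

Fact galg_mul1 : left_id (galg_pt 0) galg_mul.
Proof.
move=> f; apply/ffunP => x; rewrite ffunE (bigD1 0)//= ffunE eqxx mul1r subr0.
by rewrite big1 ?addr0// => y /negPf y0; rewrite ffunE y0 mul0r.
Qed.

Fact galg_mulDl : left_distributive galg_mul +%R.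
Proof.
move=> f g h; apply/ffunP => x; rewrite !ffunE -big_split/=.
by apply: eq_bigr => y _; rewrite ffunE mulrDl.
Qed.

Fact galg_1neq0 : galg_pt 0 != 0.
Proof.
by apply/eqP => /ffunP/(_ 0); rewrite !ffunE eqxx => /eqP; rewrite oner_eq0.
Qed.

HB.instance Definition _ := GRing.Zmodule_isComNzRing.Build (galg R G)
  galg_mulA galg_mulC galg_mul1 galg_mulDl galg_1neq0.

Fact galg_scaleA a b f : galg_scale a (galg_scale b f) = galg_scale (a * b) f.
Proof. by apply/ffunP => x; rewrite !ffunE mulrA. Qed.

Fact galg_scale1 : left_id 1 galg_scale.
Proof. by move=> f; apply/ffunP => x; rewrite !ffunE mul1r. Qed.

Fact galg_scaleDr : right_distributive galg_scale +%R.
Proof. by move=> a f g; apply/ffunP => x; rewrite !ffunE mulrDr. Qed.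

Fact galg_scaleDl f : {morph galg_scale^~ f : a b / a + b}.
Proof. by move=> a b; apply/ffunP => x; rewrite !ffunE mulrDl. Qed.

HB.instance Definition _ := GRing.Zmodule_isLmodule.Build R (galg R G)
  galg_scaleA galg_scale1 galg_scaleDr galg_scaleDl.

Fact galg_scaleAl a f g : a *: (f * g) = (a *: f) * g.
Proof.
apply/ffunP => x; rewrite !ffunE mulr_sumr.
by apply: eq_bigr => y _; rewrite ffunE mulrA.
Qed.

HB.instance Definition _ := GRing.Lmodule_isLalgebra.Build R (galg R G)
  galg_scaleAl.
HB.instance Definition _ := GRing.Lalgebra_isComAlgebra.Build R (galg R G).

Lemma galgM f g x : (f * g) x = \sum_y f y * g (x - y).
Proof. by rewrite ffunE. Qed.

Lemma galg1 x : (1 : galg R G) x = (x == 0)%:R.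
Proof. by rewrite ffunE. Qed.

Lemma galgZ a f x : (a *: f) x = a * f x.
Proof. by rewrite ffunE. Qed.

Lemma galgD f g x : (f + g) x = f x + g x.
Proof. by rewrite ffunE. Qed.

Lemma galgN f x : (- f) x = - f x.
Proof. by rewrite ffunE. Qed.

Lemma galg_sumE (I : Type) (r : seq I) (P : pred I) (F : I -> galg R G) x :
  (\sum_(i <- r | P i) F i) x = \sum_(i <- r | P i) F i x.
Proof. by elim/big_rec2: _ => [|i a f _ <-]; rewrite ffunE. Qed.

Lemma galg_ptM x f y : (galg_pt x * f) y = f (y - x).
Proof.
rewrite galgM (bigD1 x)//= ffunE eqxx mul1r big1 ?addr0// => z /negPf zx.
by rewrite ffunE zx mul0r.
Qed.

Lemma galg_ptD x y : galg_pt x * galg_pt y = galg_pt (x + y).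
Proof. by apply/ffunP => z; rewrite galg_ptM !ffunE subr_eq addrC. Qed.

Definition aug f : R := \sum_x f x.

Lemma augM f g : aug (f * g) = aug f * aug g.
Proof.
rewrite /aug mulr_suml; under eq_bigr do rewrite galgM.
rewrite exchange_big/=; apply: eq_bigr => y _.
by rewrite (reindex_inj (addIr y))/= mulr_sumr; under eq_bigr do rewrite addrK.
Qed.

Lemma augD f g : aug (f + g) = aug f + aug g.
Proof. by rewrite /aug -big_split; apply: eq_bigr => x _; rewrite galgD. Qed.

Lemma aug_sum (I : Type) (r : seq I) (P : pred I) (F : I -> galg R G) :
  aug (\sum_(i <- r | P i) F i) = \sum_(i <- r | P i) aug (F i).
Proof.
by rewrite /aug exchange_big/=; apply: eq_bigr => x _; rewrite galg_sumE.
Qed.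

Lemma augZ a f : aug (a *: f) = a * aug f.
Proof. by rewrite /aug mulr_sumr; under eq_bigr do rewrite galgZ. Qed.

Lemma aug_pt x : aug (galg_pt x) = 1.
Proof.
rewrite /aug (bigD1 x)//= ffunE eqxx big1 ?addr0// => y /negPf yx.
by rewrite ffunE yx.
Qed.

Lemma aug1 : aug 1 = 1. Proof. exact: aug_pt. Qed.

Lemma aug_prod (I : Type) (r : seq I) (P : pred I) (F : I -> galg R G) :
  aug (\prod_(i <- r | P i) F i) = \prod_(i <- r | P i) aug (F i).
Proof. by elim/big_rec2: _ => [|i a f _ <-]; rewrite ?aug1 ?augM. Qed.

Definition gsym f := forall x, f (- x) = f x.

Lemma gsym1 : gsym 1.
Proof. by move=> x; rewrite !galg1 oppr_eq0. Qed.

Lemma gsymM f g : gsym f -> gsym g -> gsym (f * g).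
Proof.
move=> sf sg x; rewrite !galgM (reindex_inj oppr_inj)/=.
by apply: eq_bigr => y _; rewrite sf -opprD sg.
Qed.

Lemma gsymB f g : gsym f -> gsym g -> gsym (f - g).
Proof. by move=> sf sg x; rewrite !galgD !galgN sf sg. Qed.

Definition ginner f g := \sum_x f x * g x.

Lemma ginnerMl k f g : gsym k -> ginner (k * f) g = ginner f (k * g).
Proof.
move=> sk; rewrite /ginner.
under eq_bigr do rewrite galgM mulr_suml.
under [RHS]eq_bigr do rewrite galgM mulr_sumr.
rewrite exchange_big/= [RHS]exchange_big/= [RHS](reindex_inj oppr_inj)/=.
apply: eq_bigr => y _; rewrite (reindex_inj (addIr y))/=.
apply: eq_bigr => x _; rewrite addrK sk opprK; ring.
Qed.

End GroupAlgebra.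

Arguments galg_pt {R G}.

(** * Pointwise order and sums of p-th powers *)

Section Order.
Variables (R : realType) (G : finZmodType).
Implicit Types (f g h k : galg R G) (x y z : G) (p : R).

Definition gle f g := forall x, f x <= g x.

Lemma gle0M f g : gle 0 f -> gle 0 g -> gle 0 (f * g).
Proof.
move=> f0 g0 x; rewrite ffunE galgM; apply: sumr_ge0 => y _.
by have := f0 y; have := g0 (x - y); rewrite !ffunE => ? ?; rewrite mulr_ge0.
Qed.

Lemma gle01 : gle 0 (1 : galg R G).
Proof. by move=> x; rewrite galg1 ffunE. Qed.

Lemma gle0_pt z : gle 0 (galg_pt z : galg R G).
Proof. by move=> x; rewrite !ffunE. Qed.

Lemma gle0P f : gle 0 f -> forall x, 0 <= f x.
Proof. by move=> f0 x; have := f0 x; rewrite ffunE. Qed.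

Lemma gle0I f : (forall x, 0 <= f x) -> gle 0 f.
Proof. by move=> f0 x; rewrite ffunE. Qed.

Lemma gle0_prod (I : Type) (r : seq I) (P : pred I) (F : I -> galg R G) :
  (forall i, P i -> gle 0 (F i)) -> gle 0 (\prod_(i <- r | P i) F i).
Proof.
move=> F0; elim/big_rec: _ => [|i f Pi]; first exact: gle01.
by apply: gle0M; exact: F0.
Qed.

Lemma gle0_sum (I : Type) (r : seq I) (P : pred I) (F : I -> galg R G) :
  (forall i, P i -> gle 0 (F i)) -> gle 0 (\sum_(i <- r | P i) F i).
Proof.
move=> F0; apply: gle0I => x; rewrite galg_sumE.
by apply: sumr_ge0 => i Pi; apply: gle0P; exact: F0.
Qed.

Lemma gleMl k f g : gle 0 k -> gle f g -> gle (k * f) (k * g).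
Proof.
move=> k0 fg x; rewrite !galgM; apply: ler_sum => y _.
by rewrite ler_wpM2l//; exact: gle0P.
Qed.

(** For f >= 0, the p-th power of the L^p norm; without the root it adds up over points and
    levels. *)
Definition psum p f := \sum_x f x `^ p.

Lemma psum_ge0 p f : 0 <= psum p f.
Proof. by apply: sumr_ge0 => x _; exact: powR_ge0. Qed.


Lemma psumZ p (a : R) f : 0 <= a -> gle 0 f ->
  psum p (a *: f) = a `^ p * psum p f.
Proof.
move=> a0 f0; rewrite /psum mulr_sumr; apply: eq_bigr => x _.
by rewrite galgZ powRM//; exact: gle0P.
Qed.

Lemma psumD_le p f g : 0 <= p -> gle 0 f -> gle 0 g ->
  psum p (f + g) <= 2 `^ p * (psum p f + psum p g).
Proof.
move=> p0 f0 g0; rewrite /psum -big_split mulr_sumr; apply: ler_sum => x _.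
by rewrite galgD powRD_le//; exact: gle0P.
Qed.

Lemma psum_average (I : finType) p (F : I -> galg R G) (c : R) (h : galg R G) :
    1 < p -> (0 < #|I|)%N -> (forall i, gle 0 (F i)) ->
    (forall i, psum p (F i) <= c) ->
    h = #|I|%:R^-1 *: \sum_i F i ->
  psum p h <= c.
Proof.
move=> p1 I0 F0 Fc ->.
have IR : #|I|%:R != 0 :> R by rewrite pnatr_eq0 -lt0n.
have cst (a : R) : \sum_(i : I) #|I|%:R^-1 * a = a.
  by rewrite -mulr_sumr sumr_const -[a *+ _]mulr_natl mulKf.
apply: (@le_trans _ _ (\sum_x \sum_i #|I|%:R^-1 * F i x `^ p)).
  apply: ler_sum => x _; rewrite galgZ galg_sumE mulr_sumr.
  apply: powR_jensen => //.
  - by move=> i; rewrite invr_ge0.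
  - by under eq_bigr do rewrite -[_^-1]mulr1; exact: cst.
  - by move=> i; exact: gle0P.
rewrite exchange_big/=; under eq_bigr do rewrite -mulr_sumr.
apply: (@le_trans _ _ (\sum_(i : I) #|I|%:R^-1 * c)).
  by apply: ler_sum => i _; rewrite ler_wpM2l ?invr_ge0//; exact: Fc.
by rewrite cst.
Qed.

Lemma psum_translate p z f : psum p (galg_pt z * f) = psum p f.
Proof.
rewrite /psum (reindex_inj (addIr z))/=.
by apply: eq_bigr => x _; rewrite galg_ptM addrK.
Qed.

Lemma psum_conv_le p k f : 1 < p -> gle 0 k -> aug k = 1 -> gle 0 f ->
  psum p (k * f) <= psum p f.
Proof.
move=> p1 k0 k1 f0.
apply: (@le_trans _ _ (\sum_x \sum_y k y * f (x - y) `^ p)).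
  apply: ler_sum => x _; rewrite galgM; apply: powR_jensen => // y.
    exact: gle0P.
  exact: gle0P.
rewrite exchange_big/=.
rewrite (eq_bigr (fun y => k y * psum p f)).
  by rewrite -mulr_suml [X in X * _]k1 mul1r.
move=> y _; rewrite -mulr_sumr; congr (_ * _).
by rewrite (reindex_inj (addIr y))/=; apply: eq_bigr => x _; rewrite addrK.
Qed.

End Order.

(** * Averages over subgroups and the maximal inequality of Doob *)

Section Averages.
Variables (R : realType) (G : finZmodType).
Implicit Types (f g h k : galg R G) (x y z : G) (p : R) (H : {set G}).

Definition gunif H : galg R G := [ffun x => #|H|%:R^-1 * (x \in H)%:R].
Definition ginvariant H f := forall y x, y \in H -> f (x + y) = f x.
Definition is_subgroup H := zmod_closed (mem H).

Lemma gle0_unif H : gle 0 (gunif H).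
Proof. by move=> x; rewrite !ffunE mulr_ge0// invr_ge0. Qed.

Lemma subgroup_card H : is_subgroup H -> #|H|%:R != 0 :> R.
Proof.
by case=> H0 _; rewrite pnatr_eq0 -lt0n; apply/card_gt0P; exists 0.
Qed.

Lemma aug_unif H : is_subgroup H -> aug (gunif H) = 1.
Proof.
move=> sH; rewrite /aug.
under eq_bigr do rewrite ffunE mulr_natr mulrb.
by rewrite -big_mkcond sumr_const -[_ *+ _]mulr_natl mulfV ?subgroup_card.
Qed.

Lemma subgroupN H y : is_subgroup H -> (- y \in H) = (y \in H).
Proof.
case=> H0 HB.
have HN z : z \in H -> - z \in H by move=> zH; rewrite -sub0r HB.
by apply/idP/idP => [/HN|/HN//]; rewrite opprK.
Qed.

Lemma gsym_unif H : is_subgroup H -> gsym (gunif H).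
Proof. by move=> sH x; rewrite !ffunE subgroupN. Qed.

Lemma ginvariantM H k f : ginvariant H f -> ginvariant H (k * f).
Proof.
move=> Hf y x yH; rewrite !galgM; apply: eq_bigr => z _.
by rewrite addrAC (Hf y).
Qed.

Lemma ginvariant_unif H : is_subgroup H -> ginvariant H (gunif H).
Proof.
move=> sH y x yH; rewrite !ffunE; congr (_ * _%:R); congr nat_of_bool.
have [_ HB] := sH.
apply/idP/idP => xH; first by rewrite -(addrK y x) HB.
by rewrite -[y]opprK HB// subgroupN.
Qed.

Lemma unif_invariant H f : is_subgroup H -> ginvariant H f -> gunif H * f = f.
Proof.
move=> sH Hf; apply/ffunP => x; rewrite galgM.
rewrite (eq_bigr (fun y => gunif H y * f x)).
  by rewrite -mulr_suml [X in X * _](aug_unif sH) mul1r.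
move=> y _; rewrite ffunE; have [yH|] := boolP (y \in H); last by rewrite mulr0 !mul0r.
by rewrite (Hf (- y))// subgroupN.
Qed.

Lemma ginvariant_unifM H f : is_subgroup H -> ginvariant H (gunif H * f).
Proof. by move=> sH; rewrite mulrC; apply/ginvariantM/ginvariant_unif. Qed.

Lemma unif_idem H : is_subgroup H -> gunif H * gunif H = gunif H.
Proof. by move=> sH; exact/unif_invariant/ginvariant_unif. Qed.

Definition gmax f g : galg R G := [ffun x => Num.max (f x) (g x)].

(** The maximum of f and its successive averages over H_1, H_1 + H_2, and so on; for subgroups these
    averages form a reversed martingale. *)
Fixpoint doob (s : seq {set G}) f : galg R G :=
  if s is H :: s' then gmax f (doob s' (gunif H * f)) else f.

Lemma ginvariant_doob H s f : ginvariant H f -> ginvariant H (doob s f).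
Proof.
elim: s f => [|K s IHs] f Hf//= y x yH; rewrite !ffunE (Hf y)//.
by congr Num.max; apply: IHs => //; exact: ginvariantM.
Qed.

Lemma doob_ge s f : gle f (doob s f).
Proof. by case: s => [|H s] x//=; rewrite ffunE le_max lexx. Qed.

Lemma doob_prefix (n : nat) s f :
  gle ((\prod_(H <- take n s) gunif H) * f) (doob s f).
Proof.
elim: s n f => [|H s IHs] [|n] f /=; rewrite ?big_nil ?mul1r//.
- exact: (doob_ge (H :: s)).
- rewrite big_cons mulrAC mulrC => x; rewrite [gmax _ _ _]ffunE le_max.
  by apply/orP; right; exact: IHs.
Qed.

(* No stopping time is needed: doob s (gunif H * f) is H-invariant, so that its *)
(* pairings with f and with gunif H * f agree.                                  *)
Lemma doob_weak p s f : 1 < p -> {in s, forall H, is_subgroup H} -> gle 0 f ->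
  (p - 1) * psum p (doob s f) <= p * \sum_x doob s f x `^ (p - 1) * f x.
Proof.
move=> p1; have p0 : 0 < p by lra.
elim: s f => [|H s IHs] f sH f0 /=.
  rewrite (_ : \sum_x _ = psum p f).
    by have := psum_ge0 p f; lra.
  by apply: eq_bigr => x _; rewrite mulrC mulr_powRB1//; exact: gle0P.
have sH0 : is_subgroup H by apply: sH; rewrite mem_head.
set g := gunif H * f; set u := doob s g.
have g0 : gle 0 g by apply: gle0M => //; exact: gle0_unif.
have u0 x : 0 <= u x by apply: le_trans (gle0P g0 x) _; exact: doob_ge.
have Hu : ginvariant H u by apply/ginvariant_doob/ginvariant_unifM.
have IH : (p - 1) * psum p u <= p * \sum_x u x `^ (p - 1) * f x.
  apply: (le_trans (IHs g _ g0)).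
    by move=> K Ks; apply: sH; rewrite inE Ks orbT.
  rewrite ler_pM2l// -/u.
  have := ginnerMl [ffun x => u x `^ (p - 1)] f (gsym_unif sH0).
  rewrite unif_invariant//; last by move=> y x yH; rewrite !ffunE Hu.
  rewrite /ginner => e; rewrite le_eqVlt; apply/orP; left; apply/eqP.
  transitivity (\sum_x [ffun x => u x `^ (p - 1)] x * g x).
    by apply: eq_bigr => x _; rewrite ffunE.
  by rewrite /g -e; apply: eq_bigr => x _; rewrite ffunE.
suff : (p - 1) * psum p (gmax f u) - (p - 1) * psum p u <=
    p * \sum_x (gmax f u x `^ (p - 1) * f x) -
    p * \sum_x (u x `^ (p - 1) * f x) by lra.
rewrite /psum !mulr_sumr -!sumrB; apply: ler_sum => x _; rewrite ffunE.
have [fu|uf] := leP (f x) (u x); first by rewrite !subrr.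
have fx := gle0P f0 x.
rewrite [f x `^ _ * f x]mulrC mulr_powRB1//.
(* Where f exceeds u, the claim is exactly Young's inequality. *)
have := powR_young p1 fx (u0 x); lra.
Qed.

Lemma doob_psum p s f : 1 < p -> {in s, forall H, is_subgroup H} -> gle 0 f ->
  psum p (doob s f) <= 2 `^ p / (p - 1) * psum p f.
Proof.
move=> p1 sH f0; have p0 : 0 < p by lra.
have := doob_weak p1 sH f0.
have d0 x : 0 <= doob s f x by apply: le_trans (gle0P f0 x) _; exact: doob_ge.
have : p * \sum_x doob s f x `^ (p - 1) * f x <=
    1 / 2 * (2 `^ p * psum p f + (p - 1) * psum p (doob s f)).
  rewrite /psum !mulr_sumr -big_split/= !mulr_sumr; apply: ler_sum => x _.
  have fx := gle0P f0 x.
  (* Young is applied to 2 f so that the maximal function comes back with the factor (p - 1) / 2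
     only and can be absorbed. *)
  have := powR_young p1 (_ : 0 <= 2 * f x) (d0 x).
  rewrite powRM// => /(_ (mulr_ge0 _ fx)).
  move=> /(_ (ler0n _ 2)); lra.
move=> h1 h2; rewrite mulrAC ler_pdivlMr; last by lra.
lra.
Qed.

End Averages.

(** * Symmetrised products *)

Section SymmetricProducts.
Variables (A : comNzRingType) (M : nat).
Implicit Types (h g : 'I_M -> A) (S : {set 'I_M}).

(** Summing over all orderings makes positions interchangeable, so a linear relation between g and h
    becomes the recursion [symprodS] in (a, b). It serves twice: g = 1 - h gives differences in the
    radius, g a subgroup average gives binomial mixtures. *)
Definition symprod h g (a b : nat) : A :=
  \sum_(s : 'S_M) \prod_(j < M)
    (if (j < a)%N then h (s j) else if (j < a + b)%N then g (s j) else 1).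

Definition elsym h (r : nat) : A :=
  \sum_(S : {set 'I_M} | #|S| == r) \prod_(i in S) h i.

Lemma sum_perm_swap (F : 'I_M -> 'I_M -> A) (t : 'S_M) :
  \sum_(s : 'S_M) \prod_j F (t j) (s j) = \sum_(s : 'S_M) \prod_j F j (s j).
Proof.
rewrite (reindex_inj (mulgI t))/=; apply: eq_bigr => s _.
rewrite [RHS](reindex_inj (@perm_inj _ t))/=.
by apply: eq_bigr => j _; rewrite permM.
Qed.

(* Expand the factor at position a + b, then exchange the positions a and a + b. *)
Lemma symprodS h g (al ga : A) a b : (a + b < M)%N ->
  (forall i, g i = al + ga * h i) ->
  symprod h g a b.+1 = al * symprod h g a b + ga * symprod h g a.+1 b.
Proof.
move=> abM gE.
have aM : (a < M)%N by lia.
pose i0 := Ordinal aM; pose j0 := Ordinal abM.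
pose F (j i : 'I_M) := if (j < a.+1)%N then h i
  else if (j < a.+1 + b)%N then g i else 1.
rewrite [symprod h g a.+1 b]/symprod -(sum_perm_swap F (tperm i0 j0)).
rewrite !mulr_sumr -big_split/=; apply: eq_bigr => s _.
rewrite !(bigD1 j0 (P := predT))//= tpermR /F /= ltnn ltnSn.
rewrite addnS ltnSn (_ : (a + b < a)%N = false) ?mul1r; last by lia.
rewrite gE mulrDl mulrA; congr (_ * _ + _ * _).
  apply: eq_bigr => j; rewrite -val_eqE/= => jj0.
  by have -> : (j < (a + b).+1)%N = (j < a + b)%N by lia.
apply: eq_bigr => j jj0.
case: (eqVneq j i0) jj0 => [->|ji0] jj0.
  rewrite tpermL /= ltnn.
  have b0 : (0 < b)%N.
    rewrite lt0n; apply/eqP => b0; move: jj0; by rewrite -val_eqE/= b0 addn0 eqxx.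
  have -> : (a < (a + b).+1)%N by lia.
  have -> : (a + b < a.+1)%N = false by lia.
  by have -> : (a + b < a.+1 + b)%N by lia.
rewrite tpermD 1?eq_sym//.
move: jj0 ji0; rewrite -!val_eqE/= => jj0 ji0.
have -> : (j < a.+1)%N = (j < a)%N by lia.
by have -> : (j < (a + b).+1)%N = (j < a + b)%N by lia.
Qed.

Lemma perm_initial S : exists t : 'S_M, forall j, (t j < #|S|)%N = (j \in S).
Proof.
case: M S => [|m] S; first by exists 1%g => -[].
pose u := enum S ++ enum (~: S).
have uu : uniq u.
  rewrite cat_uniq !enum_uniq andbT /=.
  by apply/hasPn => j; rewrite !mem_enum inE.
have su : size u = m.+1.
  by rewrite size_cat -!cardE cardsC card_ord.
have tinj : injective (fun j : 'I_m.+1 => nth ord0 u j).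
  by move=> i j /eqP; rewrite nth_uniq ?su// => /eqP/val_inj.
exists (perm tinj)^-1%g => j; rewrite -[j in RHS](permKV (perm tinj)).
rewrite permE; move: ((perm tinj)^-1%g j) => i.
rewrite nth_cat -cardE; case: ltnP => iS.
  by rewrite -mem_enum mem_nth// -cardE.
have : nth ord0 (enum (~: S)) (i - #|S|) \in ~: S.
  rewrite -mem_enum mem_nth// -cardE -(ltn_add2l #|S|) subnKC//.
  by rewrite cardsC card_ord.
by rewrite inE => /negbTE.
Qed.

Lemma sum_perm_set h g S :
  \sum_(s : 'S_M) \prod_(i in S) h (s i) = symprod h g #|S| 0.
Proof.
have [t tS] := perm_initial S.
pose F (j i : 'I_M) := if (j < #|S|)%N then h i else 1.
transitivity (\sum_(s : 'S_M) \prod_j F (t j) (s j)).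
  by apply: eq_bigr => s _; rewrite big_mkcond; apply: eq_bigr => j _; rewrite /F tS.
rewrite sum_perm_swap; apply: eq_bigr => s _; apply: eq_bigr => j _.
by rewrite addn0 /F; case: ifP.
Qed.

Lemma elsym_symprod h g r : (r <= M)%N ->
  (M`!)%:R * elsym h r = 'C(M, r)%:R * symprod h g r 0.
Proof.
move=> rM.
have -> : (M`!)%:R * elsym h r = \sum_(s : 'S_M) elsym (h \o s) r.
  rewrite (eq_bigr (fun=> elsym h r)).
    by rewrite sumr_const card_Sn mulr_natl.
  move=> s _; rewrite /elsym [RHS](reindex_inj (imset_inj (@perm_inj _ s)))/=.
  apply: eq_big => [S|S _]; first by rewrite card_imset//; exact: perm_inj.
  by rewrite big_imset//= => ? ? _ _; exact: perm_inj.
rewrite /elsym exchange_big/= (eq_bigr (fun=> symprod h g r 0)).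
  by rewrite sumr_const -cardsE card_draws card_ord mulr_natl.
by move=> S /eqP Sr; rewrite (sum_perm_set h g) Sr.
Qed.

End SymmetricProducts.

Lemma symprod_eigen (R : comNzRingType) (A : comAlgType R) (M : nat)
    (h g : 'I_M -> A) (l k : 'I_M -> R) (P : A) a b :
  (forall i, h i * P = l i *: P) -> (forall i, g i * P = k i *: P) ->
  symprod h g a b * P = symprod l k a b *: P.
Proof.
move=> hP gP; rewrite mulr_suml scaler_suml; apply: eq_bigr => s _.
elim/big_rec2: _ => [|j x y _ xyP]; first by rewrite mul1r scale1r.
rewrite -mulrA xyP -scalerAr [in RHS]mulrC -scalerA; congr (_ *: _).
by case: ifP => _; [|case: ifP => _; last by rewrite mul1r scale1r].
Qed.

(** * Spectral estimate for differences of sphere averages *)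

Section Steps.
Variables (R : realType) (G : finZmodType).
Implicit Types (f g : galg R G) (x y : G) (H : {set G}).

Definition gstep H : galg R G :=
  [ffun x => (#|H|.-1)%:R^-1 * ((x \in H) && (x != 0))%:R].

Lemma gle0_step H : gle 0 (gstep H).
Proof. by move=> x; rewrite !ffunE mulr_ge0// invr_ge0. Qed.

(** Through the idempotent of H the eigenvalues of a step are seen to be 1 and -1 / (|H| - 1). *)
Lemma gstepE H : is_subgroup H -> (1 < #|H|)%N ->
  gstep H = (1 + (#|H|.-1)%:R^-1) *: gunif R H - (#|H|.-1)%:R^-1 *: 1.
Proof.
move=> [H0 _] H1; apply/ffunP => x.
rewrite galgD galgN !galgZ galg1 !ffunE.
set h := #|H| in H1 *; have -> : h%:R = 1 + h.-1%:R :> R.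
  by rewrite addrC natr1 prednK// ltnW.
have h1 : 0 < h.-1%:R :> R by rewrite ltr0n -subn1 subn_gt0.
have h2 : 0 < 1 + h.-1%:R :> R by lra.
have [->|x0] := eqVneq x 0; first by rewrite [0 \in H]H0/=; field; rewrite !gt_eqF.
by case: (x \in H) => /=; field; rewrite !gt_eqF.
Qed.

Lemma unif_stepE H : is_subgroup H -> (1 < #|H|)%N ->
  gunif R H = (#|H|%:R^-1)%:A + (1 - #|H|%:R^-1)%:A * gstep H.
Proof.
move=> sH H1; rewrite gstepE// -scalerAl mul1r.
set h := #|H| in H1 *; have -> : h%:R = 1 + h.-1%:R :> R.
  by rewrite addrC natr1 prednK// ltnW.
have h1 : 0 < h.-1%:R :> R by rewrite ltr0n -subn1 subn_gt0.
have h2 : 0 < 1 + h.-1%:R :> R by lra.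
rewrite scalerBr !scalerA addrCA -scalerBl -[LHS]addr0 -[gunif R H in LHS]scale1r.
by congr (_ *: _ + _); [|rewrite -[LHS](scale0r 1); congr (_ *: _)];
  field; rewrite !gt_eqF.
Qed.

Lemma aug_step H : is_subgroup H -> (1 < #|H|)%N -> aug (gstep H) = 1.
Proof.
move=> sH H1; rewrite gstepE// -scaleN1r augD !augZ aug_unif// aug1; ring.
Qed.

Section Spectrum.
Variables (M q : nat) (H : 'I_M -> {set G}).
Hypothesis q1 : (2 < q)%N.
Hypothesis sH : forall i, is_subgroup (H i).
Hypothesis cH : forall i, #|H i| = q.
Implicit Types (W : {set 'I_M}).

Let a : R := q.-1%:R^-1.
Let e i := gunif R (H i).
Let t i := gstep (H i).
Let a0 : 0 < a. Proof. by rewrite invr_gt0 ltr0n; lia. Qed.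
(** This is where q >= 3 enters: the eigenvalue -a stays at distance at least 1/2 from -1. *)
Let a12 : 2 * a <= 1.
Proof. by rewrite ler_pdivrMr ?mul1r ?ltr0n ?ler_nat; lia. Qed.

Definition spec W := \prod_i (if i \in W then 1 - e i else e i).
Definition speceig W i : R := if i \in W then - a else 1.

Lemma sum_spec : \sum_W spec W = 1.
Proof.
transitivity (\prod_(i < M) ((1 - e i) + e i)); last first.
  by rewrite big1// => i _; rewrite subrK.
by rewrite bigA_distr.
Qed.

Lemma unif_spec W i : e i * spec W = (i \notin W)%:R *: spec W.
Proof.
rewrite /spec (bigD1 i)//=; case: (i \in W); rewrite mulrA.
  by rewrite mulrBr mulr1 unif_idem// subrr mul0r scale0r.
by rewrite unif_idem// scale1r.
Qed.

Lemma step_spec W i : t i * spec W = speceig W i *: spec W.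
Proof.
rewrite /t gstepE ?cH//; last by apply: ltnW.
rewrite mulrBl -!scalerAl unif_spec mul1r scalerA -scalerBl -/a /speceig.
by case: (i \in W); congr (_ *: _) => /=; ring.
Qed.

Lemma spec_orth W W' : W != W' -> spec W * spec W' = 0.
Proof.
move=> WW'.
suff [i iW] : exists i, (i \in W) != (i \in W').
  have := unif_spec W i; have := unif_spec W' i.
  have h : e i * spec W * spec W' = spec W * (e i * spec W').
    by rewrite mulrA (mulrC (spec W)).
  move=> h1 h2; move: h; rewrite h1 h2 -scalerAl -scalerAr.
  move: iW; case: (i \in W); case: (i \in W') => //= _.
    by rewrite scale0r scale1r.
  by rewrite scale0r scale1r.
apply/existsP; rewrite -negb_forall; apply: contraNN WW' => /forallP h.
by apply/eqP/setP => i; apply/eqP.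
Qed.

Lemma gsym_spec W : gsym (spec W).
Proof.
rewrite /spec; elim/big_rec: _ => [|i k _ sk]; first exact: gsym1.
apply: gsymM => //; case: ifP => _; last exact: gsym_unif.
by apply: gsymB; [exact: gsym1|exact: gsym_unif].
Qed.

(** Plancherel for the orthogonal decomposition of f into the [spec W * f], on each of which P is a
    scalar. *)
Lemma ginner_eigen (P : galg R G) (phi : {set 'I_M} -> R) f :
  (forall W, P * spec W = phi W *: spec W) ->
  ginner (P * f) (P * f) =
    \sum_W phi W ^+ 2 * ginner (spec W * f) (spec W * f).
Proof.
move=> Pphi.
have PE : P * f = \sum_W phi W *: (spec W * f).
  rewrite -[P]mulr1 -sum_spec mulr_sumr mulr_suml.
  by apply: eq_bigr => W _; rewrite Pphi scalerAl.
have orth W W' : W != W' -> ginner (spec W * f) (spec W' * f) = 0.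
  move=> WW'; rewrite ginnerMl; last exact: gsym_spec.
  by rewrite mulrA spec_orth// mul0r /ginner big1// => x _; rewrite ffunE mulr0.
rewrite {1}PE {1}/ginner; under eq_bigr do rewrite galg_sumE mulr_suml.
rewrite exchange_big/=; apply: eq_bigr => W _.
rewrite PE; under eq_bigr do rewrite galg_sumE mulr_sumr.
rewrite exchange_big/= (bigD1 W)//= [X in _ + X]big1 ?addr0.
  rewrite /ginner mulr_sumr; apply: eq_bigr => x _; rewrite !galgZ; ring.
move=> W' W'W; rewrite eq_sym in W'W.
transitivity (phi W * phi W' * ginner (spec W * f) (spec W' * f)).
  rewrite /ginner mulr_sumr; apply: eq_bigr => x _; rewrite !galgZ; ring.
by rewrite orth// mulr0.
Qed.

(* Up to the sign (-1)^m, the m-th difference in r of the sphere averages *)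
(* gdiff r 0.                                                             *)
Definition gdiff r m : galg R G :=
  (M`!)%:R^-1 *: symprod t (fun i => 1 - t i) r m.

Definition diff_const m : R :=
  (m`! * m.+1`!)%:R * (((1 + a) / (1 - a)) ^+ m.+1 * ((1 + a) / (1 - a)) ^+ m.+1).

(* Each eigenvalue l of a step satisfies `|l| = 1 - nu and 1 - l = kap * nu for *)
(* some 0 <= nu <= 1; replacing l by `|l| and 1 - l by kap * nu turns the       *)
(* differences into those of a completely monotone sequence.                    *)
Lemma sum_gdiff_le m f :
  \sum_(r < M - m) r.+1%:R ^+ (m + m.+1) *
     ginner (gdiff r m.+1 * f) (gdiff r m.+1 * f) <= diff_const m * ginner f f.
Proof.
set kap := (1 + a) / (1 - a).
move: (a0) (a12) => ha0 ha12.
have kap0 : 0 < kap by rewrite divr_gt0; lra.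
have fact0 : 0 < (M`!)%:R :> R by rewrite ltr0n fact_gt0.
pose l W i : R := `|speceig W i|.
pose l' W i : R := `|1 - speceig W i|.
pose y W (r k : nat) : R := (M`!)%:R^-1 * symprod (l W) (l' W) r k.
pose z W (r k : nat) : R := (M`!)%:R^-1 *
  symprod (speceig W) (fun i => 1 - speceig W i) r k.
have zP W r k : gdiff r k * spec W = z W r k *: spec W.
  rewrite -scalerAl (symprod_eigen (l := speceig W)
      (k := fun i => 1 - speceig W i)) ?scalerA// => i.
    exact: step_spec.
  by rewrite mulrBl mul1r step_spec scalerBl scale1r.
have zy W r k : `|z W r k| <= y W r k.
  rewrite /y /z normrM [`|_^-1|]ger0_norm ?invr_ge0// ler_wpM2l ?invr_ge0//.
  apply: (le_trans (ler_norm_sum _ _ _)); apply: ler_sum => s _.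
  rewrite normr_prod le_eqVlt; apply/orP; left; apply/eqP.
  by apply: eq_bigr => j _; case: ifP => // _; case: ifP => // _; rewrite normr1.
have y0 W r k : 0 <= y W r k by exact: le_trans (zy W r k).
have yS W r k : (r + k < M)%N ->
    y W r k.+1 = kap * (y W r k - y W r.+1 k).
  move=> rk; rewrite /y (symprodS (al := kap) (ga := - kap))//; first by ring.
  move=> i; rewrite /l /l' /speceig; case: ifP => _.
    rewrite opprK normrN !ger0_norm /kap; [|lra|lra].
    by field; rewrite gt_eqF//; lra.
  by rewrite subrr normr0 normr1; ring.
have y00 W : y W 0 0 <= 1.
  rewrite /y /symprod (eq_bigr (fun=> 1)).
    by rewrite sumr_const card_Sn mulVf// gt_eqF.
  by move=> s _; rewrite big1.
have zW W : \sum_(r < M - m) r.+1%:R ^+ (m + m.+1) * z W r m.+1 ^+ 2 <=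
    diff_const m.
  apply: le_trans (sum_sqr_diff_le kap0 (fun r k _ => y0 W r k)
    (yS W) (y00 W) m).
  apply: ler_sum => r _; rewrite ler_wpM2l ?exprn_ge0//.
  by rewrite -real_normK ?num_real// lerXn2r ?nnegrE.
under eq_bigr => r _ do
  rewrite (@ginner_eigen _ (fun W => z W r m.+1))// mulr_sumr.
rewrite exchange_big/=.
have -> : ginner f f = \sum_W ginner (spec W * f) (spec W * f).
  rewrite -{1 2}[f]mul1r (@ginner_eigen _ (fun=> 1)) => [|W].
    by apply: eq_bigr => W _; rewrite expr1n mul1r.
  by rewrite mul1r scale1r.
rewrite mulr_sumr; apply: ler_sum => W _.
under eq_bigr do rewrite mulrA.
rewrite -mulr_suml ler_wpM2r// /ginner sumr_ge0// => x _.
by rewrite -expr2 sqr_ge0.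
Qed.

End Spectrum.
End Steps.

(** * Majorants of the sphere averages *)

Lemma symprod0 (A : comNzRingType) (M : nat) (h g g' : 'I_M -> A) r :
  symprod h g r 0 = symprod h g' r 0.
Proof.
apply: eq_bigr => s _; apply: eq_bigr => j _.
by rewrite addn0; case: (j < r)%N.
Qed.

Lemma prod_take_enum (A : comNzRingType) (M k : nat) (F : 'I_M -> A) :
  \prod_(j <- take k (enum 'I_M)) F j =
  \prod_(j < M) (if (j < k)%N then F j else 1).
Proof.
have tE : take k (enum 'I_M) = [seq j <- enum 'I_M | (val j < k)%N].
  apply: (inj_map val_inj); rewrite map_take val_enum_ord.
  rewrite -(filter_map val (fun i => (i < k)%N)) val_enum_ord take_iota.
  have [kM|Mk] := leqP k M; first by rewrite -(filter_iota_ltn 0 kM).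
  symmetry; apply/all_filterP/allP => i; rewrite mem_iota => /andP[_]; lia.
rewrite tE big_filter big_enum_cond/= -big_mkcond.
by [].
Qed.

Section SphereMajorant.
Variables (R : realType) (G : finZmodType).
Variables (M q : nat) (H : 'I_M -> {set G}).
Hypothesis q1 : (2 < q)%N.
Hypothesis sH : forall i, is_subgroup (H i).
Hypothesis cH : forall i, #|H i| = q.
Implicit Types (f g : galg R G).

Definition gsphere r : galg R G := gdiff R H r 0.

Let fact0 : 0 < (M`!)%:R :> R. Proof. by rewrite ltr0n fact_gt0. Qed.

Lemma gle0_sphere r : gle 0 (gsphere r).
Proof.
apply: gle0I => x; rewrite galgZ mulr_ge0 ?invr_ge0//; apply: gle0P.
apply: gle0_sum => s _; apply: gle0_prod => j _.
by rewrite addn0; case: (j < r)%N; [exact: gle0_step|exact: gle01].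
Qed.

Lemma aug_sphere r : aug (gsphere r) = 1.
Proof.
rewrite augZ aug_sum (eq_bigr (fun=> 1)).
  by rewrite sumr_const card_Sn mulVf// gt_eqF.
move=> s _; rewrite aug_prod big1// => j _; rewrite addn0.
by case: (j < r)%N; rewrite ?aug1// aug_step// cH; apply: ltnW.
Qed.

(** The bound 6 (u + v) of [cesaro_bound], with u the permutation average of Doob maximal functions
    and v the full Cesaro mean; it controls the means of all lengths. *)
Definition sphere_majorant f : galg R G :=
  6 *: ((M`!)%:R^-1 *: \sum_(s : 'S_M) doob [seq H (s j) | j <- enum 'I_M] f
    + M.+1%:R^-1 *: \sum_(j < M.+1) gsphere j * f).

Lemma gle0_doob s f : gle 0 f -> gle 0 (doob s f).
Proof.
by move=> f0; apply: gle0I => x; apply: (le_trans (gle0P f0 x)); exact: doob_ge.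
Qed.

Lemma gle0_perm_doob f : gle 0 f ->
  gle 0 ((M`!)%:R^-1 *: \sum_(s : 'S_M) doob [seq H (s j) | j <- enum 'I_M] f).
Proof.
move=> f0; apply: gle0I => x; rewrite galgZ mulr_ge0 ?invr_ge0//.
by apply: gle0P; apply: gle0_sum => s _; exact: gle0_doob.
Qed.

Lemma gle0_avg_sphere f : gle 0 f ->
  gle 0 (M.+1%:R^-1 *: \sum_(j < M.+1) gsphere j * f).
Proof.
move=> f0; apply: gle0I => x; rewrite galgZ mulr_ge0 ?invr_ge0//.
by apply: gle0P; apply: gle0_sum => s _; apply: gle0M => //; exact: gle0_sphere.
Qed.

Lemma gle0_majorant f : gle 0 f -> gle 0 (sphere_majorant f).
Proof.
move=> f0; apply: gle0I => x; rewrite galgZ galgD mulr_ge0// addr_ge0//.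
  exact: (gle0P (gle0_perm_doob f0)).
exact: (gle0P (gle0_avg_sphere f0)).
Qed.

Lemma psum_majorant p f : 1 < p -> gle 0 f ->
  psum p (sphere_majorant f) <=
    6 `^ p * (2 `^ p * (2 `^ p / (p - 1) + 1)) * psum p f.
Proof.
move=> p1 f0; have p0 : 0 <= p by lra.
have u0 := gle0_perm_doob f0; have v0 := gle0_avg_sphere f0.
rewrite psumZ//; last first.
  by apply: gle0I => x; rewrite galgD addr_ge0//; [exact: (gle0P u0)|exact: (gle0P v0)].
rewrite -!mulrA ler_wpM2l ?powR_ge0//.
apply: (le_trans (psumD_le p0 u0 v0)).
rewrite ler_wpM2l ?powR_ge0// mulrDl mul1r; apply: lerD.
  apply: (psum_average (F := fun s : 'S_M =>
    doob [seq H (s j) | j <- enum 'I_M] f)) => //.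
  - by rewrite card_Sn fact_gt0.
  - by move=> s; exact: gle0_doob.
  - by move=> s; apply: doob_psum => // K /mapP[j _ ->].
  - by rewrite card_Sn.
apply: (psum_average (F := fun j : 'I_M.+1 => gsphere j * f)) => //.
- by rewrite card_ord.
- by move=> j; apply: gle0M => //; exact: gle0_sphere.
- by move=> j; apply: psum_conv_le => //; [exact: gle0_sphere|exact: aug_sphere].
- by rewrite card_ord.
Qed.

(* By unif_stepE a product of k subgroup averages is a binomial mixture of *)
(* products of steps, so cesaro_bound compares the two families.           *)
Lemma sphere_cesaro f x n : gle 0 f -> (n <= M)%N ->
  \sum_(j < n.+1) (gsphere j * f) x <= n.+1%:R * sphere_majorant f x.
Proof.
move=> f0 nM.
pose y i k := (((M`!)%:R^-1 *: symprod (fun i => gstep R (H i))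
   (fun i => gunif R (H i)) i k) * f) x.
have y_sphere j : y j 0%N = (gsphere j * f) x.
  by rewrite /y /gsphere /gdiff (symprod0 _ _ (fun i => 1 - gstep R (H i))).
under eq_bigr do rewrite -y_sphere.
rewrite galgZ galgD !galgZ.
have qR : 0 < q%:R :> R by rewrite ltr0n; lia.
apply: (@cesaro_bound R q%:R^-1 _ _ M) => //.
- by rewrite invr_ge0 ltW.
- by rewrite -[leRHS](mulfV (lt0r_neq0 qR)) ler_pM2r ?invr_gt0// ler_nat.
- move=> i j _; apply: gle0P; apply: gle0M => //; apply: gle0I => z.
  rewrite galgZ mulr_ge0 ?invr_ge0//; apply: gle0P.
  apply: gle0_sum => s _; apply: gle0_prod => k _.
  case: ifP => _; first exact: gle0_step.
  by case: ifP => _; [exact: gle0_unif|exact: gle01].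
- move=> i j ij; rewrite /y (symprodS (al := (q%:R^-1)%:A)
    (ga := (1 - q%:R^-1)%:A))//; last first.
    by move=> k; rewrite unif_stepE ?cH//; apply: ltnW.
  rewrite -!scalerAl !mul1r mulrDl -!scalerAl galgZ galgD !galgZ; ring.
- move=> k kM; rewrite /y -scalerAl galgZ ler_wpM2l ?invr_ge0//.
  rewrite mulr_suml !galg_sumE; apply: ler_sum => s _.
  have := doob_prefix k [seq H (s j) | j <- enum 'I_M] f x.
  rewrite -map_take big_map prod_take_enum.
  exact.
rewrite mulrA mulfV ?mul1r ?pnatr_eq0// galg_sumE.
by under eq_bigr do rewrite y_sphere.
Qed.

Definition gmaximal f : galg R G :=
  [ffun x => \big[Num.max/0]_(r < M.+1) (gsphere r * f) x].

Lemma gle0_maximal f : gle 0 (gmaximal f).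
Proof.
apply: gle0I => x; rewrite ffunE; elim/big_rec: _ => // r y _ y0.
by rewrite le_max y0 orbT.
Qed.

Lemma gmaximal_le f x c : 0 <= c ->
  (forall r, (r <= M)%N -> (gsphere r * f) x <= c) -> gmaximal f x <= c.
Proof.
move=> c0 h; rewrite ffunE; elim/big_rec: _ => // r y _ yc.
by rewrite ge_max yc h// -ltnS.
Qed.

Lemma gmaximal_ge f x r : (r <= M)%N -> (gsphere r * f) x <= gmaximal f x.
Proof.
move=> rM; rewrite [gmaximal f x]ffunE.
exact: (le_bigmax_cond 0 (fun r : 'I_M.+1 => (gsphere r * f) x)
  (isT : predT (Ordinal (rM : (r < M.+1)%N)))).
Qed.

Definition square_function m f : galg R G :=
  [ffun x => \sum_(r < M - m) r.+1%:R ^+ (m + m.+1) * (gdiff R H r m.+1 * f) x ^+ 2].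

Lemma square_function_ge0 m f x : 0 <= square_function m f x.
Proof.
rewrite ffunE; apply: sumr_ge0 => r _.
by rewrite mulr_ge0 ?sqr_ge0// exprn_ge0.
Qed.

Lemma sum_square_function m f :
  \sum_x square_function m f x <= diff_const R q m * ginner f f.
Proof.
apply: le_trans (sum_gdiff_le q1 sH cH m f).
under eq_bigr do rewrite ffunE.
rewrite exchange_big/=; apply: ler_sum => r _.
by rewrite -mulr_sumr.
Qed.

Lemma sphere_window m f x L n : gle 0 f -> (0 < L)%N -> (n <= M)%N ->
  exists d : R, [/\ 0 <= d,
    (gsphere n * f) x <= window_const R m * (L%:R * sphere_majorant f x) + d &
    d ^+ 2 * L%:R ^+ m.+1 <= m.+1%:R * square_function m f x].
Proof.
move=> f0 L0 nM.
have := @window_bound R M m (fun r k => (gdiff R H r k * f) x)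
  (sphere_majorant f x).
rewrite [square_function m f x]ffunE; apply => //.
- move=> r k rk; rewrite /gdiff (symprodS (al := 1) (ga := -1))//.
    by rewrite mulN1r mul1r scalerBr mulrBl galgD galgN.
  by move=> i; rewrite mulN1r.
- by move=> r _; apply: gle0P; apply: gle0M => //; exact: gle0_sphere.
- exact: (gle0P (gle0_majorant f0)).
- by move=> k kM; exact: sphere_cesaro.
Qed.

End SphereMajorant.

(** * Optimisation of the smoothing scale and summation over levels *)

Section Optimize.
Variable R : realType.
Implicit Types (p c t A S v : R).

Lemma powR_ge1 (a x : R) : 1 <= a -> 0 <= x -> 1 <= a `^ x.
Proof. by move=> a1 x0; have := ler_powR a1 x0; rewrite powRr0. Qed.

Lemma powR_gt1 (a x : R) : 1 < a -> 0 < x -> 1 < a `^ x.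
Proof.
move=> a1 x0; have := gt0_ltr_powR x0 _ _ a1.
by rewrite powR1 !nnegrE => -> //; lra.
Qed.

(* The estimate for t is used with L of the order of A^(-(1 - p0 / p1)). *)
Lemma window_optimize (p0 p1 c : R) (m : nat) : 1 < p0 -> p0 < p1 -> p1 < 2 ->
    1 <= (1 - p0 / p1) * m.+1%:R -> 0 <= c ->
  forall t A S, 0 <= t -> t <= 1 -> 0 <= A -> 0 <= S -> (A = 0 -> t = 0) ->
    (forall L : nat, (0 < L)%N -> exists d : R, [/\ 0 <= d,
       t <= c * (L%:R * A) + d & d ^+ 2 * L%:R ^+ m.+1 <= m.+1%:R * S]) ->
  t `^ p1 <= 2 `^ p1 * ((2 * c) `^ p1 + 1 + m.+1%:R) * (A `^ p0 + S).
Proof.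
move=> p01 p0p1 p12 hm c0 t A S t0 t1 A0 S0 At hL.
have p1_0 : 0 < p1 by lra.
have two1 : 1 <= 2 `^ p1 :> R by apply: powR_ge1; lra.
have c2 : 0 <= (2 * c) `^ p1 := powR_ge0 _ _.
have m0 : 0 <= m.+1%:R :> R by [].
have AS0 : 0 <= A `^ p0 + S by rewrite addr_ge0 ?powR_ge0.
have [A1|A1] := leP 1 A.
  apply: (@le_trans _ _ 1); first by have := powR_le (ltW p1_0) t0 t1; rewrite powR1.
  have h : 1 <= A `^ p0 by apply: powR_ge1; lra.
  have : 1 <= (2 * c) `^ p1 + 1 + m.+1%:R by lra.
  move=> h3; rewrite -mulrA; set k := _ + m.+1%:R in h3 *.
  have h4 : 1 <= k * (A `^ p0 + S) by move: S0 => ?; nra.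
  by move: two1 => ?; nra.
have [A_0|An0] := eqVneq A 0.
  rewrite (At A_0) powR0 ?gt_eqF//.
  by apply: mulr_ge0 => //; apply: mulr_ge0; lra.
have Apos : 0 < A by rewrite lt_neqAle eq_sym A0 andbT.
set ep := 1 - p0 / p1 in hm.
have ep0 : 0 < ep by rewrite subr_gt0 ltr_pdivrMr// mul1r.
(* B A = A^(p0 / p1), so the term with L A has p1-th power of order A^p0. *)
pose B := A `^ (- ep).
have B1 : 1 <= B.
  by rewrite -[leLHS](powRr0 A) /B; apply: ger_powR; [rewrite Apos ltW|lra].
have B0 : 0 <= B by lra.
pose L := (Num.truncn B).+1.
have BL : B <= L%:R by apply/ltW/truncnS_gt.
have LB : L%:R <= 2 * B.
  by have := truncn_le B; rewrite B0 /L -natr1; lra.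
have [d [d0 td dS]] := hL L isT.
have BA : B * A = A `^ (1 - ep).
  by rewrite -{1}[A]powRr1// /B -powRD ?(addrC 1)// (gt_eqF Apos) implybT.
(* ep (m + 1) >= 1 makes L^(m + 1) at least 1 / A. *)
have dAS : d ^+ 2 <= m.+1%:R * S * A.
  rewrite -ler_pdivrMr//; apply: le_trans dS; rewrite ler_wpM2l ?sqr_ge0//.
  apply: (@le_trans _ _ (B ^+ m.+1)); last first.
    by rewrite lerXn2r ?nnegrE.
  rewrite -powR_mulrn// /B -powRrM -(powR_inv1 A0).
  by apply: ger_powR; [rewrite Apos ltW|lra].
(* If d <= A, the power of A suffices. Otherwise d^(p1 - 2) <= A^(p1 - 2), and the factor A of [dAS]
   leaves A^(p1 - 1) <= 1. *)
have dp : d `^ p1 <= A `^ p0 + m.+1%:R * S.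
  have [dA|Ad] := leP d A.
    apply: (@le_trans _ _ (A `^ p0)); last by rewrite lerDl mulr_ge0.
    apply: (@le_trans _ _ (A `^ p1)); first by rewrite powR_le// ltW.
    by apply: ger_powR; [rewrite Apos ltW|lra].
  apply: (@le_trans _ _ (m.+1%:R * S)); last by rewrite lerDr powR_ge0.
  have dpos : 0 < d by apply: lt_trans Ad.
  have -> : d `^ p1 = d ^+ 2 / d `^ (2 - p1).
    rewrite -powR_mulrn// -powRN -powRD ?(gt_eqF dpos) ?implybT//.
    by congr (_ `^ _); ring.
  rewrite ler_pdivrMr ?powR_gt0//; apply: (le_trans dAS).
  rewrite ler_wpM2l ?mulr_ge0//.
  apply: (@le_trans _ _ (A `^ (2 - p1))).
    by rewrite -[leLHS](powRr1 A0); apply: ger_powR; [rewrite Apos ltW|lra].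
  by rewrite powR_le//; lra.
have tle : t <= 2 * c * A `^ (1 - ep) + d.
  apply: (le_trans td); rewrite lerD2r -BA.
  rewrite [leRHS](_ : _ = c * (2 * B * A)); last by ring.
  by rewrite ler_wpM2l// ler_wpM2r.
have cA0 : 0 <= 2 * c * A `^ (1 - ep) by rewrite mulr_ge0 ?powR_ge0//; lra.
apply: (@le_trans _ _ ((2 * c * A `^ (1 - ep) + d) `^ p1)).
  by rewrite powR_le// ltW.
apply: (le_trans (powRD_le (ltW p1_0) cA0 d0)).
rewrite -[leRHS]mulrA ler_wpM2l ?powR_ge0// powRM ?powR_ge0//; last by lra.
rewrite -powRrM (_ : (1 - ep) * p1 = p0); last by rewrite /ep; field; rewrite gt_eqF.
have : 0 <= (2 * c) `^ p1 * S by rewrite mulr_ge0.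
have : 0 <= m.+1%:R * A `^ p0 by rewrite mulr_ge0 ?powR_ge0.
by lra.
Qed.

Lemma sum_low_levels (J : nat) v tau : 0 <= v -> 0 <= tau ->
  \sum_(j < J) (if v / 2 ^+ j < tau then v / 2 ^+ j else 0) <= 2 * tau.
Proof.
move=> v0 tau0; elim: J v v0 => [|J IHJ] v v0; first by rewrite big_ord0; lra.
have [vt|tv] := ltP v tau.
  apply: (@le_trans _ _ (\sum_(j < J.+1) v / 2 ^+ j)).
    apply: ler_sum => j _; case: ifP => // _.
    by rewrite mulr_ge0// invr_ge0 exprn_ge0.
  have -> : \sum_(j < J.+1) v / 2 ^+ j = 2 * v - v / 2 ^+ J.
    elim: J {IHJ} => [|J IHJ]; first by rewrite big_ord1 expr0; lra.
    by rewrite big_ord_recr/= IHJ exprS; field; rewrite expf_eq0 pnatr_eq0 andbF.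
  have : 0 <= v / 2 ^+ J by rewrite mulr_ge0// invr_ge0 exprn_ge0.
  lra.
rewrite big_ord_recl/= expr0 divr1 ltNge tv/= add0r.
rewrite (eq_bigr (fun j : 'I_J => if v / 2 / 2 ^+ j < tau then v / 2 / 2 ^+ j else 0)).
  by apply: IHJ; lra.
by move=> j _; rewrite /bump/= add1n exprS invfM mulrA.
Qed.

(** The terms grow geometrically with j, so the last level above tau dominates. *)
Lemma sum_high_levels (J : nat) v tau (g : R) : 0 < v -> 0 < tau -> 0 < g ->
  \sum_(j < J) (if tau <= v / 2 ^+ j then (v / 2 ^+ j) `^ (- g) else 0) <=
  2 `^ g / (2 `^ g - 1) * tau `^ (- g).
Proof.
move=> v0 tau0 g0; set r := 2 `^ g.
have r1 : 1 < r by apply: powR_gt1; lra.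
have vj j : 0 < v / 2 ^+ j by rewrite divr_gt0// exprn_gt0.
have vE j : (v / 2 ^+ j) `^ (- g) = v `^ (- g) * r ^+ j.
  rewrite powRM ?invr_ge0 ?exprn_ge0// ?ltW//; congr (_ * _).
  rewrite -[2 ^+ j]powR_mulrn// -powRN -powRrM.
  by rewrite /r -[RHS]powR_mulrn ?powR_ge0// -powRrM mulrC mulrNN.
elim: J => [|J IHJ].
  by rewrite big_ord0 mulr_ge0 ?powR_ge0// divr_ge0//; lra.
rewrite big_ord_recr/=; case: ifP => [tl|_]; last by rewrite addr0.
apply: (@le_trans _ _ (\sum_(j < J.+1) (v / 2 ^+ j) `^ (- g))).
  rewrite big_ord_recr/= lerD2r; apply: ler_sum => j _.
  by case: ifP => // _; exact: powR_ge0.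
have rn : r - 1 != 0 by rewrite gt_eqF; lra.
have -> : \sum_(j < J.+1) (v / 2 ^+ j) `^ (- g) =
    (r * (v / 2 ^+ J) `^ (- g) - v `^ (- g)) / (r - 1).
  elim: J {IHJ tl} => [|J IHJ].
    by rewrite big_ord1 vE expr0 mulr1; field.
  by rewrite big_ord_recr/= IHJ !vE exprS; field.
apply: (@le_trans _ _ (r / (r - 1) * (v / 2 ^+ J) `^ (- g))).
  rewrite [leRHS]mulrAC ler_wpM2r ?invr_ge0//; first by lra.
  by rewrite gerBl powR_ge0.
rewrite ler_wpM2l//; first by rewrite divr_ge0//; lra.
rewrite !powRN lef_pV2 ?posrE ?powR_gt0//.
by rewrite powR_le//; exact: ltW.
Qed.

Definition level_const (p p1 : R) : R :=
  4 `^ p * (2 `^ ((p - p1) / p1) / (2 `^ ((p - p1) / p1) - 1)) `^ p1.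

(* With S the left-hand sum, the levels below S / 4 contribute at most S / 2; on *)
(* the others a j is at most (v / 2 ^+ j)^(-(p - p1) / p1) times the p1-th root  *)
(* of the right-hand sum, and these bounds form a geometric progression.         *)
Lemma sum_levels_powR (J : nat) (p p1 v : R) (a : nat -> R) :
  1 < p1 -> p1 < p -> 0 < v ->
  (forall j, 0 <= a j) -> (forall j, a j <= v / 2 ^+ j) ->
  (\sum_(j < J) a j) `^ p <= level_const p p1 *
    \sum_(j < J) (v / 2 ^+ j) `^ (p - p1) * a j `^ p1.
Proof.
move=> p1_1 p1p v0 a0 av; set S := \sum_(j < J) a j; set E := \sum_(j < J) _.
have p1_0 : 0 < p1 by lra.
set g := (p - p1) / p1.
have g0 : 0 < g by rewrite divr_gt0//; lra.
set D := 2 `^ g / (2 `^ g - 1).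
have r1 : 1 < 2 `^ g :> R by apply: powR_gt1; lra.
have D0 : 0 <= D by rewrite divr_ge0//; lra.
have vj j : 0 < v / 2 ^+ j by rewrite divr_gt0// exprn_gt0.
have E0 : 0 <= E by apply: sumr_ge0 => j _; rewrite mulr_ge0 ?powR_ge0.
have S0 : 0 <= S by apply: sumr_ge0 => j _; exact: a0.
have [S_0|Sn0] := eqVneq S 0.
  rewrite S_0 powR0 ?gt_eqF//; last by lra.
  by rewrite mulr_ge0// /level_const mulr_ge0 ?powR_ge0.
have Spos : 0 < S by rewrite lt_neqAle eq_sym Sn0.
pose tau := S / 4.
have tau0 : 0 < tau by rewrite /tau; lra.
pose F := E `^ p1^-1.
have F0 : 0 <= F := powR_ge0 _ _.
have aF (j : 'I_J) : a j <= (v / 2 ^+ j) `^ (- g) * F.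
  have -> : a j = (a j `^ p1) `^ p1^-1.
    by rewrite -powRrM mulfV ?gt_eqF// powRr1.
  have -> : (v / 2 ^+ j) `^ (- g) = ((v / 2 ^+ j) `^ (- (p - p1))) `^ p1^-1.
    by rewrite -powRrM /g mulNr.
  rewrite -powRM ?powR_ge0// powR_le ?invr_ge0 ?powR_ge0//; first exact: ltW.
  rewrite powRN mulrC ler_pdivlMr ?powR_gt0// mulrC.
  rewrite /E (bigD1 j)//= lerDl; apply: sumr_ge0 => i _.
  by rewrite mulr_ge0 ?powR_ge0.
have hS : S <= 2 * tau + D * tau `^ (- g) * F.
  apply: (@le_trans _ _ (\sum_(j < J)
      ((if v / 2 ^+ j < tau then v / 2 ^+ j else 0) +
       (if tau <= v / 2 ^+ j then (v / 2 ^+ j) `^ (- g) else 0) * F))).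
    apply: ler_sum => j _; case: ltP => _; first by rewrite mul0r addr0.
    by rewrite add0r.
  rewrite big_split/= -mulr_suml; apply: lerD.
    by apply: sum_low_levels; exact: ltW.
  by rewrite ler_wpM2r//; exact: sum_high_levels.
have htau : tau * tau `^ g <= D * F.
  have tg : 0 < tau `^ g by rewrite powR_gt0.
  rewrite -ler_pdivlMr// -powRN -mulrA (mulrC F) mulrA.
  by move: hS; rewrite /tau; lra.
have -> : S = 4 * tau by rewrite /tau; lra.
rewrite powRM//; [|exact: ltW].
rewrite /level_const -/g -/D -mulrA ler_wpM2l ?powR_ge0//.
have -> : E = F `^ p1 by rewrite /F -powRrM mulVf ?gt_eqF// powRr1.
rewrite -powRM//.
have -> : tau `^ p = (tau * tau `^ g) `^ p1.
  rewrite powRM ?powR_ge0//; last exact: ltW.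
  rewrite -powRrM -powRD; last by rewrite (gt_eqF tau0) implybT.
  by congr (_ `^ _); rewrite /g; field; rewrite gt_eqF.
apply: powR_le => //; first exact: ltW.
by rewrite mulr_ge0 ?powR_ge0// ltW.
Qed.

End Optimize.

(** * The maximal theorem for families of subgroups *)

(** For values in [0, 1] one has f^2 <= f^p0, so the L^2 bound on the square function is paid by the
    p0-th powers, as is Doob's inequality at p0. *)
Lemma restricted_maximal (R : realType) (p0 p1 : R) (q : nat) :
    1 < p0 -> p0 < p1 -> p1 < 2 -> (2 < q)%N ->
  exists2 C : R, 0 <= C & forall (G : finZmodType) (M : nat)
      (H : 'I_M -> {set G}) (f : galg R G),
    (forall i, is_subgroup (H i)) -> (forall i, #|H i| = q) ->
    (forall x, 0 <= f x <= 1) ->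
  psum p1 (gmaximal H f) <= C * psum p0 f.
Proof.
move=> p01 p0p1 p12 q2.
have p1_0 : 0 < p1 by lra.
pose ep := 1 - p0 / p1.
have ep0 : 0 < ep by rewrite subr_gt0 ltr_pdivrMr// mul1r.
pose m := Num.truncn ep^-1.
have hm : 1 <= ep * m.+1%:R.
  by rewrite mulrC -ler_pdivrMr// mul1r; apply/ltW/truncnS_gt.
pose c := window_const R m.
have c0 : 0 <= c by rewrite mulr_ge0// exprn_ge0.
pose K := 2 `^ p1 * ((2 * c) `^ p1 + 1 + m.+1%:R).
have K0 : 0 <= K.
  by rewrite mulr_ge0 ?powR_ge0// addr_ge0// addr_ge0 ?powR_ge0.
pose C1 := 6 `^ p0 * (2 `^ p0 * (2 `^ p0 / (p0 - 1) + 1)).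
have C10 : 0 <= C1.
  rewrite mulr_ge0 ?powR_ge0// mulr_ge0 ?powR_ge0// addr_ge0//.
  by rewrite divr_ge0 ?powR_ge0//; lra.
pose C2 := diff_const R q m.
have C20 : 0 <= C2.
  rewrite /C2 /diff_const mulr_ge0// -expr2 -exprM mulnC exprM exprn_ge0//.
  by rewrite sqr_ge0.
exists (K * (C1 + C2)); first by rewrite mulr_ge0// addr_ge0.
move=> G M H f sH cH f01.
have f0 : gle 0 f by apply: gle0I => x; case/andP: (f01 x).
have S1 x n : (gsphere R H n * f) x <= 1.
  rewrite galgM -(aug_sphere R q2 sH cH n); apply: ler_sum => y _.
  rewrite -[leRHS]mulr1 ler_wpM2l//; first exact: (gle0P (gle0_sphere R H n)).
  by case/andP: (f01 (x - y)).
pose A := sphere_majorant H f.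
have ptw x : gmaximal H f x `^ p1 <= K * (A x `^ p0 + square_function H m f x).
  set B := K * _.
  have B0 : 0 <= B.
    by rewrite mulr_ge0// addr_ge0 ?powR_ge0// square_function_ge0.
  have -> : B = (B `^ p1^-1) `^ p1.
    by rewrite -powRrM mulVf ?gt_eqF// powRr1.
  rewrite powR_le//; [exact: ltW|exact: (gle0P (gle0_maximal H f))|].
  apply: gmaximal_le => [|n nM]; first exact: powR_ge0.
  set t := (gsphere R H n * f) x.
  have t0 : 0 <= t by apply: gle0P; apply: gle0M => //; exact: gle0_sphere.
  have -> : t = (t `^ p1) `^ p1^-1.
    by rewrite -powRrM mulfV ?gt_eqF// powRr1.
  rewrite powR_le ?invr_ge0 ?powR_ge0//; first exact: ltW.
  apply: (window_optimize p01 p0p1 p12 hm c0) => //.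
  - exact: S1.
  - exact: (gle0P (gle0_majorant H f0)).
  - exact: square_function_ge0.
  - move=> Ax0; apply/eqP; rewrite eq_le t0 andbT.
    have := sphere_cesaro q2 sH cH x f0 nM; rewrite Ax0 mulr0.
    rewrite big_ord_recr/= -/t; apply: le_trans; rewrite lerDr.
    apply: sumr_ge0 => j _; apply: gle0P; apply: gle0M => //.
    exact: gle0_sphere.
  - by move=> L L0; exact: (sphere_window q2 sH cH m x f0 L0 nM).
apply: (le_trans (ler_sum _ (fun x _ => ptw x))).
rewrite -mulr_sumr -mulrA ler_wpM2l// big_split/= mulrDl; apply: lerD.
  exact: (psum_majorant q2 sH cH p01 f0).
apply: (le_trans (sum_square_function q2 sH cH m f)).
rewrite ler_wpM2l//; apply: ler_sum => x _.
have /andP[fx0 fx1] := f01 x.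
rewrite -expr2 -powR_mulrn//.
have [->|fxn] := eqVneq (f x) 0; first by rewrite !powR0 ?gt_eqF//; lra.
by apply: ger_powR; [rewrite fx1 andbT lt_neqAle eq_sym fxn|lra].
Qed.

Lemma subgroup_spheres_maximal (R : realType) (p : R) (q : nat) :
    1 < p -> (2 < q)%N ->
  exists2 C : R, 0 <= C & forall (G : finZmodType) (M : nat)
      (H : 'I_M -> {set G}) (f : galg R G),
    (forall i, is_subgroup (H i)) -> (forall i, #|H i| = q) ->
    gle 0 f ->
  psum p (gmaximal H f) <= C * psum p f.
Proof.
move=> hp q2.
pose p1 := (1 + Num.min p 2) / 2; pose p0 := (1 + p1) / 2.
have [p1_1 p1p p12] : [/\ 1 < p1, p1 < p & p1 < 2].
  by rewrite /p1; case: (leP p 2) => ?; split; lra.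
have p01 : 1 < p0 by rewrite /p0; lra.
have p0p1 : p0 < p1 by rewrite /p0; lra.
have [C1 C10 restr] := restricted_maximal p01 p0p1 p12 q2.
have L0 : 0 <= level_const p p1 by rewrite mulr_ge0 ?powR_ge0.
exists (level_const p p1 * (C1 * 2 `^ p)).
  by rewrite mulr_ge0// mulr_ge0// powR_ge0.
move=> G M H f sH cH f0.
(* The summand 1 keeps v positive when f = 0. *)
pose v := 1 + \sum_x f x.
have v0 : 0 < v.
  by rewrite /v ltr_pwDl// sumr_ge0// => x _; exact: gle0P.
have fv x : f x <= v.
  rewrite /v (bigD1 x)//= addrCA lerDl addr_ge0// sumr_ge0// => y _.
  exact: gle0P.
have l0 j : 0 < v / 2 ^+ j by rewrite divr_gt0// exprn_gt0.
have ex_lev x : exists j : nat, f x = 0 \/ v / 2 ^+ j.+1 < f x <= v / 2 ^+ j.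
  have [fx0|fxn0] := eqVneq (f x) 0; first by exists 0%N; left.
  have fx : 0 < f x by rewrite lt_neqAle eq_sym fxn0 (gle0P f0).
  have ex : exists n : nat, v / 2 ^+ n < f x.
    exists (Num.truncn (v / f x)).+1; set n := Num.truncn _.
    rewrite ltr_pdivrMr ?exprn_gt0// mulrC -ltr_pdivrMr//.
    apply: (lt_le_trans (truncnS_gt _)); rewrite -/n -natrX ler_nat.
    exact/ltnW/ltn_expl.
  case: (ex_minnP ex) => -[|n] hn nmin.
    by move: hn; rewrite expr0 divr1 ltNge fv.
  exists n; right; rewrite hn leNgt /=; apply/negP => h.
  by have := nmin _ h; rewrite ltnn.
pose lev x := projT1 (cid (ex_lev x)).
have levP x : f x = 0 \/ v / 2 ^+ (lev x).+1 < f x <= v / 2 ^+ (lev x).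
  exact: (projT2 (cid (ex_lev x))).
pose J := (\max_x lev x).+1.
have levJ x : (lev x < J)%N by rewrite ltnS leq_bigmax.
pose h (j : nat) : galg R G :=
  [ffun x => if lev x == j then (v / 2 ^+ j)^-1 * f x else 0].
have h01 j x : 0 <= h j x <= 1.
  rewrite ffunE; case: eqP => [<-|_]; last by rewrite lexx ler01.
  rewrite mulr_ge0 ?invr_ge0 ?(gle0P f0)//=; last exact: ltW.
  rewrite ler_pdivrMl// mulr1.
  by case: (levP x) => [->|/andP[]//]; exact: ltW.
have fE : f = \sum_(j < J) (v / 2 ^+ j) *: h j.
  apply/ffunP => x; rewrite galg_sumE (bigD1 (Ordinal (levJ x)))//=.
  rewrite galgZ ffunE eqxx mulVKf ?gt_eqF// big1 ?addr0// => j.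
  rewrite -val_eqE/= eq_sym => /negPf jx.
  by rewrite galgZ ffunE jx mulr0.
pose a x (j : nat) := v / 2 ^+ j * gmaximal H (h j) x.
have mh0 j x : 0 <= gmaximal H (h j) x := gle0P (gle0_maximal H (h j)) x.
have a0 x j : 0 <= a x j by rewrite mulr_ge0// ltW.
have av x j : a x j <= v / 2 ^+ j.
  rewrite -[leRHS]mulr1 ler_wpM2l ?(ltW (l0 j))//.
  apply: gmaximal_le => // n nM.
  rewrite galgM -(aug_sphere R q2 sH cH n); apply: ler_sum => y _.
  rewrite -[leRHS]mulr1 ler_wpM2l//; first exact: (gle0P (gle0_sphere R H n)).
  by case/andP: (h01 j (x - y)).
have fa x : gmaximal H f x <= \sum_(j < J) a x j.
  apply: gmaximal_le => [|n nM]; first by apply: sumr_ge0.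
  rewrite {1}fE mulr_sumr galg_sumE; apply: ler_sum => j _.
  rewrite -scalerAr galgZ ler_wpM2l ?(ltW (l0 j))//.
  exact: gmaximal_ge.
apply: (@le_trans _ _ (\sum_x level_const p p1 *
    \sum_(j < J) (v / 2 ^+ j) `^ (p - p1) * a x j `^ p1)).
  apply: ler_sum => x _; apply: le_trans (sum_levels_powR J p1_1 p1p v0 (a0 x) (av x)).
  by rewrite powR_le//; [lra|exact: (gle0P (gle0_maximal H f))].
rewrite -mulr_sumr -mulrA ler_wpM2l// exchange_big/=.
apply: (@le_trans _ _ (\sum_(j < J) (v / 2 ^+ j) `^ p * (C1 * psum p0 (h j)))).
  apply: ler_sum => j _; rewrite -mulr_sumr.
  have -> : \sum_x a x j `^ p1 = (v / 2 ^+ j) `^ p1 * psum p1 (gmaximal H (h j)).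
    rewrite /psum mulr_sumr; apply: eq_bigr => x _.
    by rewrite powRM// ltW.
  rewrite mulrA -powRD; last by rewrite (gt_eqF (l0 j)) implybT.
  by rewrite subrK ler_wpM2l ?powR_ge0//; exact: restr.
under eq_bigr do rewrite mulrCA.
rewrite -mulr_sumr -mulrA ler_wpM2l//.
(* The change of exponent from p0 to p is harmless: on level j, v / 2^j is below 2 f and [h j] is at
   most 1. Each x belongs to one level only. *)
apply: (@le_trans _ _ (\sum_(j < J) \sum_x
    (if lev x == j then 2 `^ p * f x `^ p else 0))).
  apply: ler_sum => j _; rewrite /psum mulr_sumr; apply: ler_sum => x _.
  have /andP[hx0 hx1] := h01 j x.
  move: hx0 hx1; rewrite ffunE; case: eqP => [<-|_] hx0 hx1; last first.
    by rewrite powR0 ?mulr0//; lra.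
  case: (levP x) => [fx0|/andP[lfx _]].
    by rewrite fx0 mulr0 !powR0 ?mulr0//; lra.
  rewrite -powRM//; last exact: (gle0P f0).
  rewrite -[leRHS]mulr1 ler_pM ?powR_ge0//.
    rewrite powR_le//; [lra|exact: ltW|].
    move: lfx; rewrite exprS invfM mulrCA => lfx; apply: ltW.
    by move: lfx; set z := v / _; lra.
  have := powR_le (_ : 0 <= p0) hx0 hx1; rewrite powR1; apply; lra.
rewrite exchange_big/= /psum mulr_sumr; apply: ler_sum => x _.
rewrite (bigD1 (Ordinal (levJ x)))//= eqxx big1 ?addr0// => j.
by rewrite -val_eqE/= eq_sym => /negPf ->.
Qed.

(** * Products of maximal bounds *)

Lemma coef_prod_1DX (A : comNzRingType) (I : finType) (h : I -> A) r :
  (\prod_i (1 + h i *: 'X))`_r =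
  \sum_(S : {set I} | #|S| == r) \prod_(i in S) h i.
Proof.
under eq_bigr do rewrite addrC.
rewrite bigA_distr coef_sum [RHS]big_mkcond/=; apply: eq_bigr => S _.
rewrite -big_mkcond/= scaler_prod prodr_const coefZ coefXn eq_sym.
by case: eqP; rewrite ?mulr1 ?mulr0.
Qed.

Section MaximalBound.
Variables (R : realType) (G : finZmodType).
Implicit Types (f g : galg R G) (P Q : {poly galg R G}) (p C D : R).

(* The coefficient of X^r stands for the unnormalised sphere of radius r; its *)
(* augmentation is the size of that sphere.                                   *)
Definition maximal_bound p C P := forall f, gle 0 f -> exists g,
  [/\ gle 0 g, psum p g <= C * psum p f &
      forall r x, (P`_r * f) x <= aug P`_r * g x].

Lemma aug_ge0 f : gle 0 f -> 0 <= aug f.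
Proof. by move=> f0; apply: sumr_ge0 => x _; exact: gle0P. Qed.

Lemma maximal_bound1 p : maximal_bound p 1 1.
Proof.
move=> f f0; exists f; split=> [//||r x]; first by rewrite mul1r.
rewrite coef1; case: (r == 0%N); first by rewrite mul1r aug1 mul1r.
by rewrite mul0r /aug big1 ?mul0r ?ffunE// => y _; rewrite ffunE.
Qed.

(** Apply the bound for Q to f, then the bound for P to the majorant so obtained. Augmentations
    multiply, so the final majorant dominates every sum of products that is a coefficient of
    [P * Q]. *)
Lemma maximal_boundM p C D P Q : 0 <= C ->
  (forall r, gle 0 P`_r) -> (forall r, gle 0 Q`_r) ->
  maximal_bound p C P -> maximal_bound p D Q -> maximal_bound p (C * D) (P * Q).
Proof.
move=> C0 P0 Q0 bP bQ f f0.
have [g1 [g10 g1p Qg1]] := bQ f f0.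
have [g [g0 gp Pg]] := bP g1 g10.
exists g; split=> // [|r x].
  by rewrite -mulrA; apply: (le_trans gp); rewrite ler_wpM2l.
rewrite coefM aug_sum mulr_suml galg_sumE mulr_suml; apply: ler_sum => i _.
rewrite -mulrA augM [aug _ * aug _]mulrC -mulrA.
apply: (@le_trans _ _ ((P`_i * (aug Q`_(r - i) *: g1)) x)).
  apply: gleMl => // y; rewrite galgZ; exact: Qg1.
by rewrite -scalerAr galgZ ler_wpM2l ?aug_ge0.
Qed.

Lemma maximal_bound_prod p (I : Type) (s : seq I) (C : I -> R)
    (P : I -> {poly galg R G}) :
  (forall i, 0 <= C i) -> (forall i r, gle 0 (P i)`_r) ->
  (forall i, maximal_bound p (C i) (P i)) ->
  maximal_bound p (\prod_(i <- s) C i) (\prod_(i <- s) P i).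
Proof.
move=> C0 P0 bP.
have Pi0 t r : gle 0 (\prod_(i <- t) P i)`_r.
  elim: t r => [|i t IHt] r; rewrite ?big_nil ?big_cons.
    by rewrite coef1; case: (r == 0%N) => x; rewrite ?galg1 ffunE.
  rewrite coefM; apply: gle0_sum => j _; exact: gle0M.
elim: s => [|i s IHs]; first by rewrite !big_nil; exact: maximal_bound1.
by rewrite !big_cons; apply: maximal_boundM.
Qed.

End MaximalBound.

Section Spheres.
Variables (R : realType) (G : finZmodType).
Implicit Types (f g : galg R G) (H : {set G}).

Lemma aug_elsym (M : nat) (h : 'I_M -> galg R G) r :
  (forall i, aug (h i) = 1) -> aug (elsym h r) = 'C(M, r)%:R.
Proof.
move=> h1; rewrite aug_sum (eq_bigr (fun=> 1)).
  by rewrite sumr_const -cardsE card_draws card_ord.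
by move=> S _; rewrite aug_prod big1.
Qed.

Lemma elsym_small (M : nat) (h : 'I_M -> galg R G) r :
  (M < r)%N -> elsym h r = 0.
Proof.
move=> Mr; rewrite /elsym big1// => S /eqP Sr.
by have := max_card S; rewrite card_ord Sr leqNgt Mr.
Qed.

Lemma elsym_sphere (M : nat) (H : 'I_M -> {set G}) r : (r <= M)%N ->
  elsym (fun i => gstep R (H i)) r = 'C(M, r)%:R *: gsphere R H r.
Proof.
move=> rM; have := elsym_symprod (fun i => gstep R (H i))
  (fun i => 1 - gstep R (H i)) rM.
rewrite !mulr_natl -!scaler_nat => e.
rewrite /gsphere /gdiff scalerA mulrC -scalerA -e scalerA mulVf ?scale1r//.
by rewrite pnatr_eq0 -lt0n fact_gt0.
Qed.

End Spheres.

Lemma subgroups_maximal_bound (R : realType) (p : R) (q : nat) :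
    1 < p -> (2 < q)%N ->
  exists2 C : R, 0 <= C & forall (G : finZmodType) (M : nat)
      (H : 'I_M -> {set G}),
    (forall i, is_subgroup (H i)) -> (forall i, #|H i| = q) ->
  maximal_bound p C (\prod_i (1 + (q.-1%:R *: gstep R (H i)) *: 'X)).
Proof.
move=> p1 q2; have [C C0 hC] := subgroup_spheres_maximal p1 q2.
exists C => // G M H sH cH f f0; exists (gmaximal H f); split.
- exact: gle0_maximal.
- exact: hC.
- move=> r x; rewrite coef_prod_1DX.
  have -> : \sum_(S : {set 'I_M} | #|S| == r)
      \prod_(i in S) (q.-1%:R *: gstep R (H i)) =
      q.-1%:R ^+ r *: elsym (fun i => gstep R (H i)) r.
    rewrite scaler_sumr; apply: eq_bigr => S /eqP Sr.
    by rewrite scaler_prod prodr_const Sr.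
  rewrite augZ -scalerAl galgZ -mulrA ler_wpM2l ?exprn_ge0//.
  rewrite aug_elsym; last by move=> i; rewrite aug_step// cH; apply: ltnW.
  have [rM|Mr] := leqP r M; last first.
    by rewrite elsym_small// mul0r ffunE bin_small// mul0r.
  by rewrite elsym_sphere// -scalerAl galgZ ler_wpM2l//; exact: gmaximal_ge.
Qed.

(** * Powers of the group of order two *)

Section Klein.
Variables (R : realType) (G : finZmodType).
Implicit Types (s t : G).

Definition klein s t : {set G} := [set x in [:: 0; s; t; s + t]].

Variables s t : G.
Hypotheses (ss : s + s = 0) (tt : t + t = 0).

Lemma klein_subgroup : is_subgroup (klein s t).
Proof.
have Ns : - s = s by apply/eqP; rewrite eq_sym -addr_eq0 ss.
have Nt : - t = t by apply/eqP; rewrite eq_sym -addr_eq0 tt.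
have stt : s + t + t = s by rewrite -addrA tt addr0.
have sst : s + (s + t) = t by rewrite addrA ss add0r.
split; first by rewrite !inE eqxx.
move=> x y; rewrite !inE => /or4P[] /eqP-> /or4P[] /eqP->;
rewrite ?opprD ?oppr0 ?Ns ?Nt ?sub0r ?Ns ?Nt ?add0r ?addr0 ?ss ?tt ?stt ?sst
  ?(addrC t s) ?(addrC t (s + t)) ?(addrC (s + t) s) ?sst ?stt ?eqxx ?orbT//.
by rewrite addrACA ss tt addr0 eqxx.
Qed.

Hypotheses (s0 : s != 0) (t0 : t != 0) (st : s != t).

Lemma klein_uniq : uniq [:: 0; s; t; s + t].
Proof.
have Nt : - t = t by apply/eqP; rewrite eq_sym -addr_eq0 tt.
rewrite /= !inE !(eq_sym 0) (negbTE s0) (negbTE t0) (negbTE st) addr_eq0 Nt.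
rewrite (negbTE st) /= -[X in ~~ (X == _)]addr0 (inj_eq (addrI s)) eq_sym t0.
by rewrite -[X in ~~ (X == _)]add0r (inj_eq (addIr t)) eq_sym s0.
Qed.

Lemma card_klein : #|klein s t| = 4.
Proof. by rewrite cardsE; exact/card_uniqP/klein_uniq. Qed.

Lemma step_klein : gstep R (klein s t) =
  3^-1 *: (galg_pt s + galg_pt t + galg_pt s * galg_pt t).
Proof.
have := klein_uniq; rewrite /= !inE !negb_or.
move=> /and4P[/and3P[h1 h2 h3] /andP[h4 h5] h6 _].
apply/ffunP => x; rewrite galg_ptD galgZ !galgD !ffunE card_klein; congr (_ * _).
rewrite !inE -!natrD; congr _%:R.
have [->|x0] := eqVneq x 0; first by rewrite andbF (negbTE h1) (negbTE h2) (negbTE h3).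
rewrite /= andbT; have [->|xs] := eqVneq x s.
  by rewrite (negbTE h4) (negbTE h5).
have [->|xt] := eqVneq x t; first by rewrite (negbTE h6).
by case: eqP.
Qed.

End Klein.

Section Cube.
Variables (R : realType) (G : finZmodType) (n : nat).
Notation N := n.+1.
Notation M := (n %/ 3)%N.
Variable u : 'I_N -> G.
Hypothesis u_inj : injective u.
Hypothesis uu : forall l, u l + u l = 0.
Implicit Types (f g : galg R G) (s : 'S_N) (S : {set 'I_N}) (b : 'I_M).

Let d l : galg R G := galg_pt (u l).
Let F k : galg R G := symprod d d k 0.

Let blk b (c : nat) : 'I_N := inord (3 * b + c).
Let blkE b c : (c < 3)%N -> blk b c = (3 * b + c)%N :> nat.
Proof. by move=> c3; rewrite inordK//; have := ltn_ord b; lia. Qed.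

(* In each triple of coordinates, the vectors of even weight form a Klein     *)
(* four-group all of whose nonzero elements have weight 2.                    *)
Definition cube_block s b : {set G} :=
  klein (u (s (blk b 0)) + u (s (blk b 1))) (u (s (blk b 0)) + u (s (blk b 2))).

Let uD s (i j : 'I_N) : i != j -> u (s i) != u (s j).
Proof. by move=> ij; rewrite (inj_eq u_inj) (inj_eq perm_inj). Qed.

Let u2 i j : u i + u j + (u i + u j) = 0.
Proof. by rewrite addrACA !uu addr0. Qed.

Let uN i : - u i = u i.
Proof. by apply/eqP; rewrite eq_sym -addr_eq0 uu. Qed.

Let blkD b c c' : (c < 3)%N -> (c' < 3)%N -> c != c' -> blk b c != blk b c'.
Proof. by move=> h h' cc'; rewrite -val_eqE/= !blkE// eqn_add2l. Qed.

Let block_hyps s b : [/\ u (s (blk b 0)) + u (s (blk b 1)) != 0,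
  u (s (blk b 0)) + u (s (blk b 2)) != 0 &
  u (s (blk b 0)) + u (s (blk b 1)) != u (s (blk b 0)) + u (s (blk b 2))].
Proof.
by split; rewrite ?addr_eq0 ?uN ?(inj_eq (addrI _)) uD// blkD.
Qed.

Lemma cube_block_subgroup s b : is_subgroup (cube_block s b).
Proof. by apply: klein_subgroup; exact: u2. Qed.

Lemma card_cube_block s b : #|cube_block s b| = 4.
Proof. by have [h1 h2 h3] := block_hyps s b; apply: card_klein. Qed.

Let step_block s b : gstep R (cube_block s b) =
  3^-1 *: (d (s (blk b 0)) * d (s (blk b 1)) + d (s (blk b 0)) * d (s (blk b 2))
    + d (s (blk b 1)) * d (s (blk b 2))).
Proof.
have [h1 h2 h3] := block_hyps s b; rewrite step_klein//.
rewrite /d !galg_ptD; congr (_ *: (_ + galg_pt _)).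
by rewrite addrACA uu add0r.
Qed.

(** Each block step is the mean of three products of two distinct coordinates outside S. Once summed
    over all permutations the three agree, since only the number of coordinates matters. *)
Let sum_blocks (B : seq 'I_M) S : uniq B ->
  (forall b c, b \in B -> (c < 3)%N -> blk b c \notin S) ->
  \sum_(s : 'S_N) (\prod_(l in S) d (s l)) * \prod_(b <- B) gstep R (cube_block s b) =
  F (#|S| + 2 * size B).
Proof.
elim: B S => [|b B IHB] S /=.
  move=> _ _; rewrite muln0 addn0 /F -sum_perm_set.
  by apply: eq_bigr => s _; rewrite big_nil mulr1.
case/andP=> bB uB SB.
have pair c c' : (c < 3)%N -> (c' < 3)%N -> c != c' ->
    \sum_(s : 'S_N) (\prod_(l in S) d (s l)) *
      (d (s (blk b c)) * d (s (blk b c')) *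
      \prod_(b <- B) gstep R (cube_block s b)) =
    F (#|S| + 2 * (size B).+1).
  move=> c3 c3' cc'.
  have nc' : blk b c' \notin S by apply: SB => //; rewrite mem_head.
  have nc : blk b c \notin blk b c' |: S.
    by rewrite !inE negb_or blkD//= SB// mem_head.
  have -> : (#|S| + 2 * (size B).+1 =
      #|blk b c |: (blk b c' |: S)| + 2 * size B)%N.
    by rewrite !cardsU1 nc nc' !add1n mulnS addnA addn2.
  rewrite -IHB//; last first.
    move=> b' i b'B i3; rewrite !inE !negb_or SB ?inE ?b'B ?orbT// andbT.
    have bb' : val b' != val b.
      by apply: contraNneq bB => /val_inj <-.
    rewrite -!val_eqE/= !blkE//; move: bb' i3 c3 c3' => /=.
    move: (b' : nat) (b : nat) => B1 B2 h1 h2 h3 h4; clear -h1 h2 h3 h4; lia.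
  by apply: eq_bigr => s _; rewrite !big_setU1//=; ring.
under eq_bigr => s _ do
  rewrite big_cons step_block -scalerAl -scalerAr 2!mulrDl 2!mulrDr.
rewrite -scaler_sumr !big_split/= !pair//.
rewrite -[X in X + _ + _]scale1r -[X in _ + X + _]scale1r -[X in _ + _ + X]scale1r.
by rewrite -!scalerDl scalerA (_ : _ * _ = 1) ?scale1r//; field.
Qed.

Let sum_spheres S rho : (rho <= M)%N ->
  (forall b c, (c < 3)%N -> blk b c \notin S) ->
  \sum_(s : 'S_N) (\prod_(l in S) d (s l)) * gsphere R (cube_block s) rho =
  F (#|S| + 2 * rho).
Proof.
move=> rM SB.
have c0 : 'C(M, rho)%:R != 0 :> R by rewrite pnatr_eq0 -lt0n bin_gt0.
apply: (scalerI c0); rewrite scaler_sumr.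
under eq_bigr do rewrite scalerAr -elsym_sphere// /elsym mulr_sumr.
rewrite exchange_big/= (eq_bigr (fun=> F (#|S| + 2 * rho))).
  by rewrite sumr_const -[X in _ *+ X]cardsE card_draws card_ord scaler_nat.
move=> B /eqP Br; rewrite -Br (cardE B) -sum_blocks ?enum_uniq//.
  by apply: eq_bigr => s _; rewrite big_enum.
by move=> b c _; exact: SB.
Qed.

Let d_aug l : aug (d l) = 1. Proof. exact: aug_pt. Qed.

Let low_radius f r : (r <= N)%N -> (2 * r <= N)%N -> gle 0 f ->
  gle (elsym d r * f) ('C(N, r)%:R *: ((N`!)%:R^-1 *:
    (\sum_(s : 'S_N) gmaximal (cube_block s) f +
     \sum_(s : 'S_N) gmaximal (cube_block s) (d (s ord_max) * f)))).
Proof.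
move=> rN r2 f0 x.
have Nf : N`!%:R != 0 :> R by rewrite pnatr_eq0 -lt0n fact_gt0.
have -> : elsym d r = 'C(N, r)%:R *: (N`!%:R^-1 *: F r).
  have := elsym_symprod d d rN; rewrite !mulr_natl -!scaler_nat => e.
  by apply: (scalerI Nf); rewrite e !scalerA -/(F r); congr (_ *: _); field.
rewrite -!scalerAl !galgZ ler_wpM2l// ler_wpM2l ?invr_ge0//.
have gm0 s h : 0 <= gmaximal (cube_block s) h x := gle0P (gle0_maximal _ h) x.
(* r / 2 is at most N / 4, hence within the number n / 3 of blocks. *)
have rM : (r./2 <= M)%N by lia.
rewrite galgD !galg_sumE -{1}(odd_double_half r) -mul2n.
case: (odd r) => /=; last first.
  have := @sum_spheres finset.set0 r./2 rM; rewrite cards0 add0n => <-; last first.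
    by move=> b c _; rewrite inE.
  rewrite mulr_suml galg_sumE -[leLHS]addr0; apply: lerD.
    by apply: ler_sum => s _; rewrite big_set0 mul1r; exact: gmaximal_ge.
  by apply: sumr_ge0.
(* The triples only use indices below 3 (n / 3) <= n, so [ord_max] is spare and supplies the odd
   unit. *)
have := @sum_spheres [set ord_max] r./2 rM; rewrite cards1 => <-; last first.
  move=> b c c3; rewrite inE -val_eqE/= blkE//.
  by have := ltn_ord b; move: (b : nat) => i ib; clear -ib c3; lia.
rewrite mulr_suml galg_sumE -[leLHS]add0r; apply: lerD.
  by apply: sumr_ge0.
apply: ler_sum => s _; rewrite big_set1 [d _ * _]mulrC -mulrA.
exact: gmaximal_ge.
Qed.

(** As each [d l] squares to 1, the product over all coordinates turns the product over a set into
    that over its complement. *)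
Let reflect_radius r : (r <= N)%N ->
  elsym d r = (\prod_l d l) * elsym d (N - r).
Proof.
move=> rN; rewrite mulr_sumr /elsym (reindex_inj (@finset.setC_inj _))/=.
apply: eq_big => [S|S _].
  have := cardsC S; rewrite card_ord; move: rN.
  move: #|~: S| #|S| => i j; clear => h1 h2.
  by apply/idP/idP => /eqP h3; apply/eqP; lia.
rewrite [X in _ = X * _](bigID (mem S))/= mulrAC -big_split/=.
rewrite [X in _ = X * _]big1 => [|l _].
  by rewrite mul1r; apply: eq_bigl => l; rewrite inE.
by rewrite /d galg_ptD uu.
Qed.

Lemma cube_maximal_bound (p C : R) : 1 < p -> 0 <= C ->
  (forall s f, gle 0 f -> psum p (gmaximal (cube_block s) f) <= C * psum p f) ->
  maximal_bound p (2 `^ p * (2 * (2 `^ p * (2 * C))))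
    (\prod_l (1 + (galg_pt (u l) : galg R G) *: 'X)).
Proof.
move=> p1 C0 hC f f0; have p0 : 0 <= p by lra.
pose w : galg R G := \prod_l d l.
pose E (h : galg R G) : galg R G := (N`!)%:R^-1 *:
    (\sum_(s : 'S_N) gmaximal (cube_block s) h +
     \sum_(s : 'S_N) gmaximal (cube_block s) (d (s ord_max) * h)).
have gm0 s (h : galg R G) : gle 0 (gmaximal (cube_block s) h) := gle0_maximal _ h.
have Ep h : gle 0 h -> gle 0 (E h) /\ psum p (E h) <= 2 `^ p * (2 * C) * psum p h.
  move=> h0; rewrite /E scalerDr.
  have a0 (Phi : 'S_N -> galg R G) : (forall s, gle 0 (Phi s)) ->
      gle 0 ((N`!)%:R^-1 *: \sum_(s : 'S_N) Phi s).
    move=> Phi0; apply: gle0I => x; rewrite galgZ mulr_ge0 ?invr_ge0//.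
    by apply: gle0P; exact: gle0_sum.
  have g1 := a0 _ (fun s => gm0 s h).
  have g2 := a0 _ (fun s => gm0 s (d (s ord_max) * h)).
  split.
    apply: gle0I => x; rewrite galgD addr_ge0//; first exact: (gle0P g1).
    exact: (gle0P g2).
  apply: (le_trans (psumD_le p0 g1 g2)); rewrite -mulrA ler_wpM2l ?powR_ge0//.
  rewrite -mulrA mulr_natl mulr2n; apply: lerD.
    apply: (psum_average (F := fun s : 'S_N => gmaximal (cube_block s) h)) => //.
    - by rewrite card_Sn fact_gt0.
    - by move=> s; exact: hC.
    - by rewrite card_Sn.
  apply: (psum_average (F := fun s : 'S_N =>
     gmaximal (cube_block s) (d (s ord_max) * h))) => //.
  - by rewrite card_Sn fact_gt0.
  - move=> s; apply: (le_trans (hC s _ _)).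
      by apply: gle0M => //; exact: gle0_pt.
    by rewrite psum_translate.
  - by rewrite card_Sn.
have w0 : gle 0 w by apply: gle0_prod => l _; exact: gle0_pt.
have w1 : aug w = 1 by rewrite aug_prod big1.
have wf0 : gle 0 (w * f) by exact: gle0M.
have [E1 Ep1] := Ep f f0; have [E2 Ep2] := Ep _ wf0.
(* [E f] serves the radii up to N / 2, [E (w * f)] the larger ones after reflection by w. *)
exists (E f + E (w * f)); split.
- by apply: gle0I => x; rewrite galgD addr_ge0//; [exact: (gle0P E1)|exact: (gle0P E2)].
- apply: (le_trans (psumD_le p0 E1 E2)); rewrite -mulrA ler_wpM2l ?powR_ge0//.
  rewrite -mulrA [2 * _]mulr_natl mulr2n; apply: lerD; first exact: Ep1.
  apply: (le_trans Ep2).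
  rewrite ler_wpM2l ?mulr_ge0 ?powR_ge0//; exact: psum_conv_le.
- move=> r x; rewrite coef_prod_1DX -/(elsym d r) aug_elsym// galgD mulrDr.
  have [rN|Nr] := leqP r N; last first.
    by rewrite elsym_small// mul0r ffunE bin_small// !mul0r addr0.
  have [r2|r2] := leqP (2 * r) N.
    apply: (le_trans (low_radius rN r2 f0 x)); rewrite galgZ lerDl.
    by rewrite mulr_ge0//; exact: (gle0P E2).
  have rN' : (N - r <= N)%N by lia.
  have r2' : (2 * (N - r) <= N)%N by lia.
  rewrite reflect_radius// mulrAC mulrC.
  apply: (le_trans (low_radius rN' r2' wf0 x)); rewrite galgZ bin_sub// lerDr.
  by rewrite mulr_ge0//; exact: (gle0P E1).
Qed.

End Cube.

(** * Spheres in the direct sum *)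

Local Open Scope complex_scope.

Section Coordinates.
Variables (R : realType) (n : nat) (N : 'I_n -> nat).
Notation K := {m : 'I_n & 'I_(N m)}.
Implicit Types (y z : cyclic_sum N) (k j : K) (S : {set K}).

Definition csum_supp y : {set K} := [set k : K | y k != 0].

Definition axis k : {set cyclic_sum N} :=
  [set y : cyclic_sum N | [forall j, (j != k) ==> (y j == 0)]].

Definition axis_pt k (t : 'Z_(tag k).+2) : cyclic_sum N :=
  [ffun j => @eqtype.dfwith K (fun i => 'Z_(tag i).+2) (fun=> 0) k t j].

Lemma csumD y z k : (y + z) k = y k + z k.
Proof. by rewrite ffunE. Qed.

Lemma csumB y z k : (y - z) k = y k - z k.
Proof. by rewrite !ffunE. Qed.

Lemma csum0 k : (0 : cyclic_sum N) k = 0.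
Proof. by rewrite ffunE. Qed.

Lemma axis_ptE k (t : 'Z_(tag k).+2) : axis_pt t k = t.
Proof. by rewrite ffunE dfwith_in. Qed.

Lemma axis_pt_out k j (t : 'Z_(tag k).+2) : k != j -> axis_pt t j = 0.
Proof. by move=> kj; rewrite ffunE dfwith_out. Qed.

Lemma axisP k y : reflect (y = axis_pt (y k)) (y \in axis k).
Proof.
rewrite inE; apply: (iffP forallP) => [h|-> j].
  apply/ffunP => j; have [<-|kj] := eqVneq k j; first by rewrite axis_ptE.
  rewrite axis_pt_out//; apply/eqP/(implyP (h j)).
  by rewrite eq_sym.
by apply/implyP => jk; rewrite axis_pt_out// eq_sym.
Qed.

Lemma axis_subgroup k : is_subgroup (axis k).
Proof.
split; first by rewrite inE; apply/forallP => j; rewrite csum0 eqxx implybT.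
move=> y z; rewrite !inE => /forallP hy /forallP hz; apply/forallP => j.
apply/implyP => jk; rewrite csumB.
by rewrite (eqP (implyP (hy j) jk)) (eqP (implyP (hz j) jk)) subrr.
Qed.

Lemma card_axis k : #|axis k| = (tag k).+2.
Proof.
have -> : axis k = [set axis_pt t | t in [set: 'Z_(tag k).+2]].
  apply/setP => y; apply/axisP/imsetP => [->|[t _ ->]].
    by exists (y k).
  by rewrite axis_ptE.
rewrite card_imset ?cardsT ?card_ord// => s t st.
by rewrite -(axis_ptE s) st axis_ptE.
Qed.

(* The indicator function of the vectors whose only nonzero coordinate is k. *)
Definition gaxis k : galg R (cyclic_sum N) :=
  (tag k).+1%:R *: gstep R (axis k).

Lemma csum_supp_eq1 k y :
  (csum_supp y == [set k]) = (y \in axis k) && (y != 0).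
Proof.
apply/eqP/andP => [h|[/axisP yE y0]].
  have yj j : (y j != 0) = (j == k).
    have : (j \in csum_supp y) = (j == k) by rewrite h inE.
    by rewrite inE.
  split; last first.
    by apply/eqP => y0; have := yj k; rewrite y0 csum0 !eqxx.
  rewrite inE; apply/forallP => j; apply/implyP => jk.
  by apply/negPn; rewrite yj.
apply/setP => j; rewrite !inE; have [->|jk] := eqVneq j k.
  apply: contraNneq y0 => yk; rewrite yE yk; apply/eqP/ffunP => i.
  have [<-|ki] := eqVneq k i; first by rewrite axis_ptE csum0.
  by rewrite axis_pt_out ?csum0.
by rewrite yE axis_pt_out ?eqxx// eq_sym.
Qed.

Lemma gaxisE k y : gaxis k y = (csum_supp y == [set k])%:R.
Proof.
rewrite galgZ ffunE card_axis /= mulrA mulfV ?pnatr_eq0// mul1r.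
by rewrite csum_supp_eq1.
Qed.

Lemma csum_supp_axis_pt k y : y k != 0 -> csum_supp (axis_pt (y k)) = [set k].
Proof.
move=> yk; apply/eqP; rewrite csum_supp_eq1; apply/andP; split.
  by apply/axisP; rewrite axis_ptE.
by apply: contraNneq yk => h; rewrite -[y k]axis_ptE h csum0.
Qed.

Lemma csum_supp_sub_axis k y :
  csum_supp (y - axis_pt (y k)) = csum_supp y :\ k.
Proof.
apply/setP => j; rewrite !inE csumB; have [->|jk] := eqVneq j k.
  by rewrite axis_ptE subrr eqxx.
by rewrite axis_pt_out ?subr0// eq_sym.
Qed.

(** Only z = [axis_pt (y k)] can contribute to the convolution, because y - z must vanish at k. *)
Lemma gaxisM k S (P : galg R (cyclic_sum N)) : k \notin S ->
  (forall y, P y = (csum_supp y == S)%:R) ->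
  forall y, (gaxis k * P) y = (csum_supp y == k |: S)%:R.
Proof.
move=> kS PE y; rewrite galgM (bigD1 (axis_pt (y k)))//= big1 ?addr0.
  rewrite gaxisE PE csum_supp_sub_axis -natrM mulnb; congr _%:R.
  have [yk|yk] := eqVneq (y k) 0.
    have -> : (csum_supp y == k |: S) = false.
      apply/eqP => h; have : k \in csum_supp y by rewrite h setU11.
      by rewrite inE yk eqxx.
    rewrite (_ : _ == [set k] = false)//; apply/eqP => h.
    have : k \in csum_supp (axis_pt (y k)) by rewrite h inE.
    by rewrite inE axis_ptE yk eqxx.
  rewrite csum_supp_axis_pt// eqxx/=; congr nat_of_bool.
  apply/eqP/eqP => [<-|->]; last by rewrite finset.setU1K.
  by rewrite finset.setD1K// inE.
move=> z zy; rewrite gaxisE PE -natrM mulnb.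
have [zk|] := eqVneq (csum_supp z) [set k] => //=.
have [yzS|] := eqVneq (csum_supp (y - z)) S => //=.
case/eqP: zy; move/eqP: zk; rewrite csum_supp_eq1 => /andP[/axisP zE _].
rewrite zE; congr axis_pt; apply/esym/eqP.
rewrite -subr_eq0 -csumB; apply: contraNT kS => h.
by rewrite -yzS inE.
Qed.

Lemma prod_gaxisE S y :
  (\prod_(k in S) gaxis k) y = (csum_supp y == S)%:R.
Proof.
have -> : S = [set k in enum S] by apply/setP => k; rewrite inE mem_enum.
rewrite (eq_bigl (mem (enum S))); last by move=> k; rewrite inE.
rewrite -big_uniq ?enum_uniq//=.
elim: (enum S) (enum_uniq S) y => [_|k s IHs /= /andP[ks us]] y.
  rewrite big_nil galg1; congr _%:R; congr nat_of_bool.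
  apply/eqP/eqP => [->|h].
    by apply/setP => k; rewrite !inE csum0 eqxx.
  apply/ffunP => k; rewrite csum0; apply/eqP.
  have : k \notin csum_supp y by rewrite h inE.
  by rewrite inE negbK.
have -> : [set i in k :: s] = k |: [set i in s] by apply/setP => i; rewrite !inE.
by rewrite big_cons; apply: gaxisM; [rewrite inE|exact: IHs].
Qed.

(** The coefficient is a sum over index sets S of size r, and the product of [gaxis] over S is the
    indicator of the vectors with support S. *)
Lemma coef_sphere r y :
  (\prod_(k : K) (1 + gaxis k *: 'X))`_r y = (y \in sphere N r)%:R.
Proof.
rewrite coef_prod_1DX galg_sumE.
under eq_bigr do rewrite prod_gaxisE.
rewrite inE /csum_weight -/(csum_supp y).
have [yr|yr] := eqVneq #|csum_supp y| r.
  rewrite (bigD1 (csum_supp y)) ?yr//= eqxx big1 ?addr0// => S /andP[_ Sy].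
  by rewrite eq_sym (negbTE Sy).
rewrite big1// => S /eqP Sr; case: eqP => // yS.
by move: yr; rewrite yS Sr eqxx.
Qed.

Lemma gle0_axis k : gle 0 (gaxis k).
Proof. by move=> y; rewrite gaxisE ffunE. Qed.

End Coordinates.

(** * One modulus at a time, and the assembly *)

Section Fibres.
Variables (R : realType) (n : nat) (p : R).
Hypothesis p1 : 1 < p.

Definition fibre_poly (N : 'I_n -> nat) (m : 'I_n) :
    {poly galg R (cyclic_sum N)} :=
  \prod_(l < N m) (1 + gaxis R (Tagged (fun i => 'I_(N i)) l) *: 'X).

Lemma fibre_poly_ge0 N m r : gle 0 (fibre_poly N m)`_r.
Proof.
rewrite coef_prod_1DX; apply: gle0_sum => S _; apply: gle0_prod => l _.
exact: gle0_axis.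
Qed.

(** For modulus at least 3 the coordinate axes are the subgroups. For modulus 2 an axis has one
    nonzero vector, [gaxis] is a point mass, and the cube bound applies. *)
Lemma fibre_maximal_bound (m : 'I_n) : exists2 C : R, 0 <= C &
  forall N : 'I_n -> nat, maximal_bound p C (fibre_poly N m).
Proof.
have [m0|m0] := posnP m; last first.
  have [C C0 hC] := @subgroups_maximal_bound R p m.+2 p1 m0.
  exists C => // N; apply: hC => l; first exact: axis_subgroup.
  exact: card_axis.
have [C C0 hC] := @subgroup_spheres_maximal R p 4 p1 isT.
(* The summand 1 covers the empty product, [N m = 0]; the rest is the constant of
   [cube_maximal_bound]. *)
exists (1 + 2 `^ p * (2 * (2 `^ p * (2 * C)))).
  by rewrite addr_ge0// !mulr_ge0 ?powR_ge0.
move=> N.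
pose T (l : 'I_(N m)) : {i : 'I_n & 'I_(N i)} := Tagged (fun i => 'I_(N i)) l.
pose u l : cyclic_sum N := axis_pt (1 : 'Z_(tag (T l)).+2).
have Z2 (t : 'Z_m.+2) : t != 0 -> t = 1.
  move=> t0; apply: val_inj; rewrite /=.
  have : (t : nat) != 0%N by [].
  have := ltn_ord t; rewrite modn_small; last by [].
  by move: (nat_of_ord t) => i; rewrite /Zp_trunc/= m0; case: i => [|[|]].
have guE l : gaxis R (T l) = galg_pt (u l).
  apply/ffunP => y; rewrite gaxisE csum_supp_eq1 ffunE; congr _%:R.
  congr nat_of_bool; apply/andP/eqP => [[/axisP yE y0]|->].
    rewrite yE; congr axis_pt; apply: Z2; apply: contraNneq y0 => yk.
    rewrite yE yk; apply/eqP/ffunP => i; rewrite csum0.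
    by have [<-|ki] := eqVneq (T l) i; rewrite ?axis_ptE ?axis_pt_out.
  split; first by apply/axisP; rewrite axis_ptE.
  by apply/eqP => /ffunP/(_ (T l)); rewrite axis_ptE csum0.
have u_inj : injective u.
  move=> l l' ll'; apply/eqP; apply: contraT => nll'.
  have : T l' != T l by rewrite -tag_eqE /tag_eq eqxx tagged_asE eq_sym.
  move=> h; have := axis_ptE (1 : 'Z_(tag (T l)).+2).
  by rewrite -/(u l) ll' axis_pt_out.
have uu l : u l + u l = 0.
  apply/ffunP => i; rewrite csumD csum0.
  have [<-|ki] := eqVneq (T l) i; last by rewrite axis_pt_out// addr0.
  rewrite axis_ptE; apply/val_inj.
  have e (a : nat) : a = 0%N -> ((1 %% a.+2 + 1 %% a.+2) %% a.+2 = 0)%N.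
    by move=> ->.
  exact: e.
rewrite /fibre_poly.
have -> : \prod_(l < N m) (1 + gaxis R (T l) *: 'X) =
    \prod_(l < N m) (1 + (galg_pt (u l) : galg R (cyclic_sum N)) *: 'X).
  by apply: eq_bigr => l _; rewrite guE.
clear guE; clearbody u; clear T; move: u u_inj uu; case: (N m) => [|k] u u_inj uu.
  rewrite big_ord0 => f f0; have [g [g0 gp h]] := @maximal_bound1 R _ p f f0.
  exists g; split=> //; apply: (le_trans gp); rewrite ler_wpM2r ?psum_ge0//.
  by rewrite lerDl !mulr_ge0 ?powR_ge0.
move=> f f0.
have [|g [g0 gp h]] := @cube_maximal_bound R _ k u u_inj uu p C p1 C0 _ f f0.
  move=> s h h0; apply: hC => // b; first exact: cube_block_subgroup.
  exact: card_cube_block.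
exists g; split=> //; apply: (le_trans gp); rewrite ler_wpM2r ?psum_ge0//.
by rewrite lerDr.
Qed.

End Fibres.

Theorem theorem1p7 (R : realType) (p : R) (n : nat) (hp : 1 < p)
    (hn : (0 < n)%N) :
  exists C : R, forall (N : 'I_n -> nat) (f : cyclic_sum N -> R[i]),
    lp_norm p (fun x => (spherical_maximal f x)%:C) <= C * lp_norm p f.
Proof.
(* The constants are chosen for each modulus before N is introduced. *)
pose D (m : 'I_n) := projT1 (cid2 (fibre_maximal_bound hp m)).
have D0 m : 0 <= D m by case: (projT2 (cid2 (fibre_maximal_bound hp m))).
have hD m N : maximal_bound p (D m) (fibre_poly R N m).
  by case: (projT2 (cid2 (fibre_maximal_bound hp m))).
exists ((\prod_m D m) `^ p^-1) => N f.
have p0 : 0 < p by rewrite (lt_trans _ hp).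
pose F : galg R (cyclic_sum N) := [ffun x => Normc.normc (f x)].
have normc0 (z : R[i]) : 0 <= Normc.normc z by case: z => a b; exact: sqrtr_ge0.
have F0 : gle 0 F by apply: gle0I => x; rewrite ffunE.
have := maximal_bound_prod (index_enum 'I_n) D0
  (fibre_poly_ge0 R (N := N)) (fun m => hD m N).
(* The products over m and over l < N m merge into the product over all coordinates that
   [coef_sphere] describes. *)
rewrite /fibre_poly (sig_big_dep predT (fun _ => predT)
  (fun m l => 1 + gaxis R (Tagged (fun i => 'I_(N i)) l) *: 'X))/=.
rewrite (eq_bigr (fun k => 1 + gaxis R k *: 'X)); last by case.
move=> /(_ F F0)[g [g0 gp hg]].
have ptw x : spherical_maximal f x <= g x.
  rewrite /spherical_maximal big_seq; elim/big_rec: _ => [|r y _ yg].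
    exact: gle0P.
  rewrite ge_max yg andbT.
  have augE : aug (\prod_(k : {m : 'I_n & 'I_(N m)}) (1 + gaxis R k *: 'X))`_r =
      #|sphere N r|%:R.
    rewrite /aug; under eq_bigr do rewrite coef_sphere.
    by rewrite -natr_sum -sum1_card [in RHS]big_mkcond.
  have := hg r x; rewrite augE galgM.
  rewrite (eq_bigr (fun z => (z \in sphere N r)%:R * Normc.normc (f (x - z))));
    last by move=> z _; rewrite coef_sphere ffunE.
  set c := #|sphere N r| => h.
  have cn : Normc.normc (c%:R^-1 : R[i]) = c%:R^-1.
    by rewrite Normc.normcV -[c%:R]mulr_natl mulr1 normcMn Normc.normc1.
  apply: (@le_trans _ _ (c%:R^-1 *
     \sum_y (y \in sphere N r)%:R * Normc.normc (f (x - y)))).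
    rewrite /convolution mulr_sumr.
    elim/big_rec2: _ => [|z a b _ ab]; first by rewrite Normc.normc0.
    apply: (le_trans (le_normcD _ _)); apply: lerD => //.
    rewrite /sphere_measure !Normc.normcM cn -mulrA.
    by case: (z \in sphere N r); rewrite ?Normc.normc0 ?Normc.normc1.
  have [c0|c0] := posnP c; first by rewrite c0 invr0 mul0r; exact: gle0P.
  by rewrite ler_pdivrMl ?ltr0n.
have -> : lp_norm p f = (psum p F) `^ p^-1.
  by rewrite /lp_norm /psum; under [in RHS]eq_bigr do rewrite ffunE.
rewrite -powRM; last exact: psum_ge0.
  rewrite /lp_norm; apply: powR_le; first by rewrite invr_ge0 ltW.
    by apply: sumr_ge0 => x _; exact: powR_ge0.
  apply: le_trans gp; apply: ler_sum => x _.
  have M0 : 0 <= spherical_maximal f x.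
    rewrite /spherical_maximal; elim/big_rec: _ => // r y _ y0.
    by rewrite le_max y0 orbT.
  apply: powR_le; first exact: ltW.
    exact: normc0.
  by rewrite /= expr0n/= addr0 sqrtr_sqr ger0_norm.
by apply: prodr_ge0 => m _; exact: D0.
Qed.
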